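(* Let $u$ be the exact solution of the delay subdiffusion problem, with $u=\varphi$ on $\Omega\times[-\tau,0]$. Assume that $|\partial_t u_{k\tau}(x,t)|\le C(1+t^{\alpha-1})$ for $t\in((k-1)\tau,k\tau]$, $k=1,2,\dots,K$, where $u_{k\tau}$ denotes the restriction of $u$ to $t\in((k-1)\tau,k\tau]$, and that $\partial_t\varphi\in L^\infty[-\tau,0]$. Then, on the symmetric graded mesh with parameter $r\ge 1$, $$\left|\left(J^{1-\alpha}-{}_0I_t^{1-\alpha}\right)u^{n-2N}\right|\lesssim \rho_1^{1/r},\qquad 1\le n\le 2KN,$$ where $J^{1-\alpha}u^{n-2N}=\sum_{k=1}^n\rho_k a^{(n)}_{n-k}u^{k-2N}$ and ${}_0I_t^{1-\alpha}u^{n-2N}=\int_0^{t_n}\omega_{1-\alpha}(t_n-s)\,u(x,s-\tau)\,ds$.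
   Context: Problem: $0<\alpha<1$, $\tau>0$, $K\in\mathbb N^+$, $p>0$, $a\le 0$, $b\ne 0$ constants, $\Omega=(0,L)$, $\Omega_T=(0,L)\times(0,K\tau]$, and $$\partial_t u(x,t)=\partial_t^{1-\alpha}\big(p\Delta u+au(x,t)\big)+bu(x,t-\tau)+f(x,t),\quad (x,t)\in\Omega_T,$$ with $u=\varphi$ on $\Omega\times[-\tau,0]$ and $u=0$ on $\partial\Omega$ for $t\in[-\tau,K\tau]$; $f$ and $\varphi$ are continuous on $\Omega_T$ and $\Omega\times[-\tau,0]$, respectively. Here $\omega_\beta(t)=t^{\beta-1}/\Gamma(\beta)$, ${}_0I_t^{\beta}v(t)=\int_0^t\omega_\beta(t-s)v(s)\,ds$ and $\partial_t^{1-\alpha}v=\partial_t\,{}_0I_t^\alpha v$. The assumed bounds on $\partial_t u$ and $\partial_t\varphi$ are understood uniformly in $x$. Symmetric graded mesh: for an integer $N\ge 2$ and $r\ge 1$, $t_{-2N}=-\tau$ and, for $i=0,1,\dots,K$, $$t_n=\begin{cases}\frac{\tau}{2}\left(\frac{n-2(i-1)N}{N}\right)^r+(i-1)\tau,& 2(i-1)N+1\le n<(2i-1)N,\\ -\frac{\tau}{2}\left(\frac{2iN-n}{N}\right)^r+i\tau,&(2i-1)N\le n\le 2iN.\end{cases}$$ Write $\rho_n=t_n-t_{n-1}$, $u^n=u(\cdot,t_n)$; note $t_{n-2N}=t_n-\tau$. The weights are $$a^{(n)}_{n-k}=\frac{\omega_{2-\alpha}(t_n-t_{k-1})-\omega_{2-\alpha}(t_n-t_k)}{\rho_k},\quad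 1\le k\le n.$$ $A\lesssim B$ means $A\le CB$ with a constant $C>0$ independent of $N$ and $n$. *)

(* Defs.v *)
From HB Require Import structures.
From mathcomp Require Import all_boot all_order all_algebra.
From mathcomp Require Import all_classical all_reals all_analysis.
Set Implicit Arguments.
Unset Strict Implicit.
Unset Printing Implicit Defensive.
Import Order.TTheory GRing.Theory Num.Theory.
Import numFieldNormedType.Exports.
Local Open Scope classical_set_scope.
Local Open Scope ring_scope.

Definition Gamma {R : realType} (beta : R) : R :=
  \int[lebesgue_measure]_(t in `]0, +oo[) (t `^ (beta - 1) * expR (- t)).

Definition omega {R : realType} (beta t : R) : R :=
  t `^ (beta - 1) / Gamma beta.

Definition frac_int {R : realType} (beta : R) (v : R -> R) (t : R) : R :=
  \int[lebesgue_measure]_(s in `]0, t[) (omega beta (t - s) * v s).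

(* Without this condition the value of [frac_int] is meaningless. *)
Definition frac_integrable {R : realType} (beta : R) (v : R -> R) (t : R) :=
  lebesgue_measure.-integrable `]0, t[
    (fun s => (omega beta (t - s) * v s)%:E).

(* Derivative at [t] of the restriction of [g] to [A]: one-sided when [t] is an
   end point of the interval [A]. *)
Definition is_derivative_in {R : realType} (A : set R) (g : R -> R) (t d : R) :=
  (g s - g t) / (s - t) @[s --> within A t^'] --> d.

(* [d] is the value at [t] of the Riemann-Liouville derivative
   D^(1-alpha) v = d/dt I^alpha v of [v] on ]0, T]. *)
Definition is_RL_derivative {R : realType} (T alpha : R) (v : R -> R)
    (t d : R) :=
  (forall s, s \in `]0, T] -> frac_integrable alpha v s) /\
  is_derivative_in `]0, T] (frac_int alpha v) t d.

(* The pointwise second derivative, Omega being one-dimensional. *)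
Definition laplacian {R : realType} (u : R -> R -> R) (x t : R) : R :=
  derive1n 2 (fun y => u y t) x.

Record exact_solution {R : realType} (L tau : R) (K : nat)
    (alpha p a b : R) (f phi u : R -> R -> R) : Prop := ExactSolution {
  sol_dxx : forall x t, x \in `]0, L[ -> t \in `]0, K%:R * tau] ->
    derivable (fun y => u y t) x 1 /\ derivable (derive1 (fun y => u y t)) x 1 ;
  sol_eq : forall x t, x \in `]0, L[ -> t \in `]0, K%:R * tau] ->
    exists ut D : R,
      [/\ is_derivative_in `]0, K%:R * tau] (u x) t ut,
          is_RL_derivative (K%:R * tau) alpha
            (fun s => p * laplacian u x s + a * u x s) t D
        & ut = D + b * u x (t - tau) + f x t] ;
  sol_init : forall x t, x \in `]0, L[ -> t \in `[- tau, 0] ->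
    u x t = phi x t ;
  sol_bnd : forall t, t \in `[- tau, K%:R * tau] -> u 0 t = 0 /\ u L t = 0
}.

(* C^1 test functions compactly supported in ]c, d[, as in Brezis' definition of
   the one-dimensional Sobolev spaces. *)
Definition test_function {R : realType} (c d : R) (psi : R -> R) :=
  [/\ forall t, derivable psi t 1,
      continuous (derive1 psi)
    & exists c' d', [/\ c < c', d' < d
        & forall t, t \notin `[c', d'] -> psi t = 0]].

(* [v] has a weak derivative in L^oo(c, d), of norm at most [M]. *)
Definition weak_derivative_Linfty {R : realType} (c d M : R) (v : R -> R) :=
  exists g : R -> R,
  [/\ measurable_fun `]c, d[ g,
      {ae lebesgue_measure, forall t, t \in `]c, d[ -> `|g t| <= M}
    & forall psi, test_function c d psi ->
        \int[lebesgue_measure]_(t in `]c, d[) (v t * derive1 psi t) =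
        - \int[lebesgue_measure]_(t in `]c, d[) (g t * psi t)].

Definition symmetric_graded_mesh {R : realType} (tau r : R) (K N : nat)
    (t : int -> R) :=
  t (- (2 * N%:Z)) = - tau /\
  forall (i : nat) (n : int), (i <= K)%N ->
    (2 * (i%:Z - 1) * N%:Z + 1 <= n -> n < (2 * i%:Z - 1) * N%:Z ->
       t n = tau / 2 * ((n - 2 * (i%:Z - 1) * N%:Z)%:~R / N%:R) `^ r
             + (i%:R - 1) * tau) /\
    ((2 * i%:Z - 1) * N%:Z <= n -> n <= 2 * i%:Z * N%:Z ->
       t n = - (tau / 2) * ((2 * i%:Z * N%:Z - n)%:~R / N%:R) `^ r
             + i%:R * tau).

Definition mesh_step {R : realType} (t : int -> R) (n : int) : R :=
  t n - t (n - 1).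

(* The weight a^(n)_(n-k), indexed by [n] and [k]. *)
Definition weight {R : realType} (alpha : R) (t : int -> R) (n k : nat) : R :=
  (omega (2 - alpha) (t n%:Z - t (k%:Z - 1))
   - omega (2 - alpha) (t n%:Z - t k%:Z)) / mesh_step t k%:Z.

(* J^(1-alpha) v^(n-2N), where v^m = v (t_m). *)
Definition J_delayed {R : realType} (alpha : R) (N : nat) (t : int -> R)
    (v : R -> R) (n : nat) : R :=
  \sum_(1 <= k < n.+1)
    mesh_step t k%:Z * weight alpha t n k * v (t (k%:Z - 2 * N%:Z)).

Definition I_delayed {R : realType} (alpha tau : R) (t : int -> R)
    (v : R -> R) (n : nat) : R :=
  frac_int (1 - alpha) (fun s => v (s - tau)) (t n%:Z).

(* Main.v *)
(* [J] replaces the delayed solution v(s) = u(x, s - tau) on each mesh cell by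
   its value at the right end point, and integrates the kernel exactly. Hence
   |J - I| <= sum_k A_k e_k, with A_k the mass of the kernel on the k-th cell and
   e_k the oscillation of v on it. The multiples of tau are mesh points and the
   cells are open on the left, so a cell never straddles a possible jump of u at
   time 0, and e_k <= c0 rho_k + c1 B_k with B_k the increment of
   max(0, s - tau)^alpha. All steps are O(1/N) and rho_1^(1/r) is a constant
   times 1/N, so it remains to see that sum_k A_k B_k = O(max rho). With T the
   (shifted) final time, concavity of powers gives
     A_k B_k <= rho_k ((T/2)^(-alpha) B_k + (T/2)^(alpha-1) A_k),
   by bounding A_k when the cell starts before T/2 and B_k otherwise, and both
   terms telescope. *)
Require Import Defs.
From HB Require Import structures.
From mathcomp Require Import all_boot all_order all_algebra.
From mathcomp Require Import all_classical all_reals all_analysis.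
From mathcomp Require Import measurable_realfun.
From mathcomp Require Import ring lra zify.
Import Order.TTheory GRing.Theory Num.Theory.
Import numFieldNormedType.Exports.
Local Open Scope classical_set_scope.
Local Open Scope ring_scope.
Set Implicit Arguments.
Unset Strict Implicit.
Unset Printing Implicit Defensive.

(** * The Gamma function and the kernel *)

Lemma continuous_powR {R : realType} (a x : R) : 0 < x ->
  {for x, continuous (fun s : R => s `^ a)}.
Proof.
move=> x0; apply: differentiable_continuous; apply/derivable1_diffP.
by have [] := is_derive1_powR a x0.
Qed.

Lemma continuous_expRN {R : realType} (x : R) :
  {for x, continuous (fun s : R => expR (- s))}.
Proof.
apply: continuous_comp; first exact: opp_continuous.
exact: continuous_expR.
Qed.

(** Compact intervals exhausting the half-line and avoiding 0, where t^(b-1) is singular for b < 1;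
    [GammaD1] integrates by parts on each of them. *)
Lemma bigcup_itv_invn {R : realType} :
  \bigcup_n `[(n.+2%:R^-1 : R), n.+2%:R]%classic = `]0, +oo[%classic.
Proof.
apply/seteqP; split => [x [n _]|x] /=; rewrite !in_itv/= ?andbT.
  by move=> /andP[+ _]; apply: lt_le_trans; rewrite invr_gt0.
move=> x0.
have [n hn] : exists n : nat, Num.max x x^-1 < n%:R.
  exists (Num.bound (Num.max x x^-1)); apply: archi_boundP.
  by rewrite le_max (ltW x0).
exists n => //=; rewrite in_itv/=; move: hn; rewrite gt_max => /andP[h1 h2].
have hn : (n%:R : R) <= n.+2%:R by rewrite ler_nat ltnW.
apply/andP; split; last by rewrite (le_trans (ltW h1)).
by rewrite -[leRHS]invrK lef_pV2 ?posrE ?invr_gt0// (le_trans (ltW h2)).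
Qed.

(* No finiteness is required: an infinite integral is read as 0 on both sides. *)
Lemma GammaD1 {R : realType} (b : R) : 0 < b < 1 -> Gamma (b + 1) = b * Gamma b.
Proof.
move=> /andP[b0 b1].
set mu := @lebesgue_measure R.
pose f (t : R) := t `^ b * expR (- t).
pose g (t : R) := b * (t `^ (b - 1) * expR (- t)).
pose E n := `[(n.+2%:R^-1 : R), n.+2%:R]%classic.
have E0 n x : E n x -> 0 < x.
  by rewrite /E/= in_itv/= => /andP[+ _]; apply: lt_le_trans; rewrite invr_gt0.
have En n : (n.+2%:R^-1 : R) < n.+2%:R.
  apply: (@lt_trans _ _ 1); last by rewrite ltr1n.
  by rewrite invf_lt1// ltr1n.
have cf (x : R) : 0 < x -> {for x, continuous f}.
  by move=> x0; apply: cvgM; [exact: continuous_powR|exact: continuous_expRN].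
have cg (x : R) : 0 < x -> {for x, continuous g}.
  move=> x0; apply: cvgM; first exact: cvg_cst.
  by apply: cvgM; [exact: continuous_powR|exact: continuous_expRN].
have wf n : {within E n, continuous f}.
  by apply: continuous_in_subspaceT => x /set_mem /E0 /cf.
have wg n : {within E n, continuous g}.
  by apply: continuous_in_subspaceT => x /set_mem /E0 /cg.
(* Integration by parts in the form f' = g - f: on each [E n] the integrals of f and g differ only
   by boundary values of f. *)
have df (x : R) : 0 < x -> is_derive x 1 f (g x - f x).
  move=> x0.
  have -> : g x - f x = x `^ b *: (expR (- x) *: -1) + expR (- x) *: (b * x `^ (b - 1)).
    rewrite /g /f; rewrite /GRing.scale/=; ring.
  apply: is_deriveM.
  exact: is_derive1_powR.
have ftc n : (\int[mu]_(x in E n) (g x)%:E =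
   \int[mu]_(x in E n) (f x)%:E + (f n.+2%:R - f n.+2%:R^-1)%:E)%E.
  have iF : mu.-integrable (E n) (EFin \o f).
    by apply: continuous_compact_integrable => //; exact: segment_compact.
  have iG : mu.-integrable (E n) (EFin \o g).
    by apply: continuous_compact_integrable => //; exact: segment_compact.
  have := @continuous_FTC2 _ (g \- f) f _ _ (En n).
  rewrite -EFinB => <-.
  - under [X in (_ + X)%E]eq_integral do rewrite EFinB.
    rewrite integralB//= addeC subeK//; exact: integrable_fin_num.
  - by move=> x; apply: cvgB; [exact: wg|exact: wf].
  - have d (x : R) : 0 < x -> derivable f x 1 by move=> /df[].
    have c (x : R) : 0 < x -> f y @[y --> x] --> f x by move=> /cf.
    split; last 2 first.
    + by apply: cvg_at_right_filter; apply: c; rewrite invr_gt0.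
    + by apply: cvg_at_left_filter; apply: c.
    + move=> x; rewrite in_itv/= => /andP[h _]; apply: d.
      by apply: lt_trans h; rewrite invr_gt0.
  - move=> x; rewrite in_itv/= => /andP[h _]; rewrite derive1E.
    have x0 : 0 < x by apply: lt_trans h; rewrite invr_gt0.
    by have [_ ->] := df _ x0.
have nd : nondecreasing_seq E.
  apply/nondecreasing_seqP => n; rewrite subsetEset; apply: subset_itv; rewrite bnd_simp.
    by rewrite lef_pV2 ?posrE// ler_nat.
  by rewrite ler_nat.
have mE n : measurable (E n) by exact: measurable_itv.
have f0 (x : R) : 0 <= f x by rewrite mulr_ge0 ?powR_ge0 ?expR_ge0.
have g0 (x : R) : 0 <= g x by rewrite mulr_ge0 ?mulr_ge0 ?powR_ge0 ?expR_ge0 ?ltW.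
have mf D : measurable_fun D f.
  apply: measurable_funTS; apply: measurable_funM; first exact: measurable_powR.
  by apply: measurableT_comp => //; exact: oppr_measurable.
have mg1 D : measurable_fun D (fun t : R => t `^ (b - 1) * expR (- t)).
  apply: measurable_funTS; apply: measurable_funM; first exact: measurable_powR.
  by apply: measurableT_comp => //; exact: oppr_measurable.
have mg D : measurable_fun D g by apply: measurable_funM.
(* Monotone convergence along [E n] carries both integrals to the half-line, in the extended
   reals. *)
have cvE (h : R -> R) : (forall x, 0 <= h x) -> (forall D, measurable_fun D h) ->
    (\int[mu]_(x in E i) (h x)%:E @[i --> \oo] --> \int[mu]_(x in `]0%R, +oo[) (h x)%:E)%E.
  move=> h0 mh; rewrite -bigcup_itv_invn.
  apply: ge0_nondecreasing_set_cvg_integral => //.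
  - by move=> i; apply: measurableT_comp => //; exact: mh.
  - by move=> i x _; rewrite lee_fin.
have cvf := cvE _ f0 mf.
have cvg' := cvE _ g0 mg.
(* The boundary terms vanish. At infinity, e^x >= x^2 / 2 gives x^b e^(-x) <= x e^(-x) <= 2 / x; at
   0, x^b tends to 0 since b > 0. *)
have F0 : (f n.+2%:R - f n.+2%:R^-1) @[n --> \oo] --> (0 : R).
  rewrite -[X in _ --> X](subrr 0); apply: cvgB.
  - apply: (@squeeze_cvgr _ _ _ _ (cst 0) (fun n => 2 * harmonic n)).
    + near=> n; rewrite {1}/cst /f mulr_ge0 ?powR_ge0 ?expR_ge0//=.
      set x : R := n.+2%:R.
      have x1 : 1 <= x by rewrite ler1n.
      have x0 : 0 < x by lra.
      have hx : x `^ b <= x by apply: ler1_powR => //; exact: ltW.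
      apply: (@le_trans _ _ (x * expR (- x))).
        by rewrite ler_wpM2r ?expR_ge0.
      have := @expR_ge1Dxn _ x 1 (ltW x0); rewrite (_ : 2`! = 2%N)// expr2 => hE.
      have hE' : x * x <= 2 * expR x by move: hE; rewrite mulrAC; lra.
      have hn : (n.+1%:R : R) <= x by rewrite ler_nat.
      rewrite expRN ler_pdivrMr ?expR_gt0//.
      apply: (@le_trans _ _ (n.+1%:R^-1 * (x * x))); last first.
        by rewrite mulrAC [leRHS]mulrC ler_wpM2l// invr_ge0.
      by rewrite mulrA ler_peMl ?(ltW x0)// [leRHS]mulrC ler_pdivlMr ?mul1r.
    + exact: cvg_cst.
    + rewrite -[X in _ --> X](mulr0 2); apply: cvgM; first exact: cvg_cst.
      exact: cvg_harmonic.
  - apply: (@squeeze_cvgr _ _ _ _ (cst 0) (fun n => n.+2%:R^-1 `^ b)).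
    + near=> n; rewrite {1}/cst /f mulr_ge0 ?powR_ge0 ?expR_ge0//=.
      by rewrite ler_piMr ?powR_ge0// expR_le1 oppr_le0 invr_ge0.
    + exact: cvg_cst.
    + have /cvg_at_rightP := powR_cvg0 b0; apply; split.
        by move=> n; rewrite invr_gt0.
      have := @cvg_harmonic R; rewrite -(cvg_shiftS (@harmonic R)).
      exact.
have PQ : (\int[mu]_(x in `]0%R, +oo[) (g x)%:E =
   \int[mu]_(x in `]0%R, +oo[) (f x)%:E)%E.
  apply: (cvg_unique _ cvg') => //.
  rewrite /= -[X in cvg_to _ (nbhs X)]adde0.
  under eq_fun do rewrite ftc.
  apply: cvgeD => //.
  - by rewrite fin_num_adde_defl.
  - by apply: cvg_EFin F0; exact: nearW.
rewrite /Gamma /Rintegral -/mu.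
under eq_integral do rewrite addrK.
rewrite -[X in fine X]PQ.
have -> : (\int[mu]_(x in `]0%R, +oo[) (g x)%:E =
    b%:E * \int[mu]_(x in `]0%R, +oo[) (x `^ (b - 1) * expR (- x))%:E)%E.
  rewrite -ge0_integralZl//=.
  - by apply: measurableT_comp => //; exact: mg1.
  - by move=> x _; rewrite lee_fin mulr_ge0 ?powR_ge0 ?expR_ge0.
  - by rewrite lee_fin ltW.
set X := (\int[mu]_(x in _) _)%E.
have X0 : (0 <= X)%E.
  by apply: integral_ge0 => x _; rewrite lee_fin mulr_ge0 ?powR_ge0 ?expR_ge0.
case: X X0 => [x||] //= _.
by rewrite gt0_muley ?lte_fin//= mulr0.
Unshelve. all: by end_near. Qed.

(** The integrand may blow up at b, as the kernel does at its final time. The usual theorem holds on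
    [a, u n] with u n increasing to b; monotone convergence gives the limit of the integrals and
    left continuity of F that of the primitives. *)
Lemma ge0_FTC2_co {R : realType} (f F : R -> R) (a b : R) : a < b ->
  (forall x, 0 <= f x) -> measurable_fun setT f ->
  (forall x, a <= x < b -> {for x, continuous f}) ->
  (forall x : R, a <= x < b -> is_derive x 1 F (f x)) ->
  F x @[x --> b^'-] --> F b ->
  (\int[lebesgue_measure]_(x in `[a, b[) (f x)%:E = (F b - F a)%:E)%E.
Proof.
move=> ab f0 mf cf dF Fb.
have ba : 0 < b - a by rewrite subr_gt0.
pose u n := b - (b - a) * n.+2%:R^-1.
have h2 n : 0 < (n.+2%:R^-1 : R) < 1.
  by rewrite invr_gt0 ltr0n invf_lt1 ?ltr1n.
have ub n : u n < b.
  by rewrite /u gtrBl mulr_gt0//; case/andP: (h2 n).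
have au n : a < u n.
  have /andP[_ h] := h2 n.
  by rewrite /u ltrBrDl -ltrBrDr gtr_pMr.
have cu : u n @[n --> \oo] --> b.
  rewrite -[X in _ --> X]subr0 -[X in _ - X](mulr0 (b - a)).
  apply: cvgB; first exact: cvg_cst.
  apply: cvgM; first exact: cvg_cst.
  have := @cvg_harmonic R; rewrite -(cvg_shiftS (@harmonic R)).
  exact.
pose E n := `[a, u n]%classic.
have bE : \bigcup_n E n = `[a, b[%classic.
  apply/seteqP; split => [x [n _]|x]; rewrite /E/= !in_itv/=.
    by move=> /andP[-> /le_lt_trans]; apply.
  move=> /andP[ax xb].
  have [n hn] : exists n, x < u n.
    have /cvgr_gt/(_ _ xb)[n _ /(_ n (leqnn n))] := cu.
    by exists n.
  by exists n => //=; rewrite in_itv/= ax ltW.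
have nd : nondecreasing_seq E.
  apply/nondecreasing_seqP => n; rewrite subsetEset; apply: subset_itvl; rewrite bnd_simp.
  rewrite lerD2l lerN2; apply: ler_wpM2l; first exact: ltW.
  by rewrite lef_pV2 ?posrE// ler_nat.
have cv : (\int[lebesgue_measure]_(x in E i) (f x)%:E @[i --> \oo] -->
    \int[lebesgue_measure]_(x in `[a, b[) (f x)%:E)%E.
  rewrite -bE; apply: ge0_nondecreasing_set_cvg_integral => //.
  - by move=> i; exact: measurable_itv.
  - by move=> i; apply: measurableT_comp => //; exact: measurable_funTS.
  - by move=> i x _; rewrite lee_fin.
have ftc n : (\int[lebesgue_measure]_(x in E n) (f x)%:E = (F (u n) - F a)%:E)%E.
  have c (x : R) : a <= x < b -> F y @[y --> x] --> F x.
    move=> /dF[dx _].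
    by apply: differentiable_continuous; apply/derivable1_diffP.
  rewrite (@continuous_FTC2 _ f F)//.
  - apply: continuous_in_subspaceT => x /set_mem/=; rewrite in_itv/= => /andP[h1 h3].
    by apply: cf; rewrite h1 (le_lt_trans h3).
  - split.
    + move=> x; rewrite in_itv/= => /andP[h1 h3].
      by have [] : is_derive x 1 F (f x) by apply: dF; rewrite ltW//= (lt_trans h3).
    + by apply: cvg_at_right_filter; apply: c; rewrite lexx.
    + by apply: cvg_at_left_filter; apply: c; rewrite ub ltW.
  - move=> x; rewrite in_itv/= => /andP[h1 h3]; rewrite derive1E.
    have [_ ->//] : is_derive x 1 F (f x).
    by apply: dF; rewrite ltW//= (lt_trans h3).
apply: (cvg_unique _ cv) => //=.
under eq_fun do rewrite ftc.
apply: cvg_EFin; first exact: nearW.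
rewrite /comp/=; apply: cvgB; last exact: cvg_cst.
have /cvg_at_leftP := Fb; apply; split => //.
Qed.

Lemma integral_powR_kernel {R : realType} (e T c d : R) :
  0 < e < 1 -> c < d -> d <= T ->
  (\int[lebesgue_measure]_(s in `]c, d]) ((T - s) `^ (e - 1))%:E =
   (((T - c) `^ e - (T - d) `^ e) / e)%:E)%E.
Proof.
move=> /andP[e0 e1] cd dT.
pose f (s : R) := (T - s) `^ (e - 1).
pose F (s : R) := - ((T - s) `^ e / e).
have dF (x : R) : x < T -> is_derive x 1 F (f x).
  move=> xT; have h : 0 < T - x by rewrite subr_gt0.
  have d1 : is_derive x 1 (fun s : R => T - s) (- 1).
    by rewrite -[- 1]sub0r; exact: is_deriveB.
  have d2 := is_derive1_powR e h.
  have d3 := @is_derive1_comp _ (fun s => s `^ e) (fun s => T - s) x _ _ d2 d1.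
  have -> : F = (- e^-1) \*: ((fun s => s `^ e) \o (fun s => T - s)).
    by apply/funext => s; rewrite /F/= /GRing.scale/= mulNr mulrC.
  have -> : f x = - e^-1 *: (e * (T - x) `^ (e - 1) * - 1).
    rewrite /f /GRing.scale/=; field; lra.
  exact: is_deriveZ.
have mf : measurable_fun setT f.
  apply: (measurableT_comp (measurable_powR (e - 1))).
  by apply: measurable_funB.
have mEf D : measurable_fun D (EFin \o f).
  by apply: measurableT_comp => //; exact: measurable_funTS.
(* Replacing ]c, d] by [c, d[ leaves out the singularity that is present when d = T. *)
rewrite -integral_itv_bndo_bndc; last exact: mEf.
rewrite integral_itv_obnd_cbnd; last exact: mEf.
have -> : ((T - c) `^ e - (T - d) `^ e) / e = F d - F c.
  by rewrite /F opprK mulrBl addrC.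
apply: (@ge0_FTC2_co _ f F) => //.
- by move=> x; exact: powR_ge0.
- move=> x /andP[_ xd]; have h : 0 < T - x by lra.
  apply: (@continuous_comp _ _ _ (fun s => T - s) (fun s => s `^ (e - 1))).
    by apply: cvgB; [exact: cvg_cst|exact: cvg_id].
  exact: continuous_powR.
- move=> x /andP[_ xd]; apply: dF; lra.
(* For d < T the primitive is differentiable at d; for d = T it is only left continuous, because e >
   0. *)
- have [dT'|dT'] := ltP d T.
    apply: cvg_at_left_filter; apply: differentiable_continuous.
    by apply/derivable1_diffP; have [] := dF _ dT'.
  have -> : d = T by lra.
  apply/cvg_at_leftP => u [uT cu].
  rewrite {2}/F subrr powR0 ?gt_eqF// mul0r.
  apply: cvgN; rewrite -[X in _ --> X](mul0r e^-1).
  apply: cvgM; last exact: cvg_cst.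
  have /cvg_at_rightP := powR_cvg0 e0; apply; split.
    by move=> n; rewrite subr_gt0.
  rewrite -(subrr T); apply: cvgB => //; exact: cvg_cst.
Qed.

Lemma Gamma_ge0 {R : realType} (b : R) : 0 <= Gamma b.
Proof. by apply: Rintegral_ge0 => x _; rewrite mulr_ge0 ?powR_ge0 ?expR_ge0. Qed.

Lemma omega_ge0 {R : realType} (b t : R) : 0 <= omega b t.
Proof. by rewrite divr_ge0 ?powR_ge0 ?Gamma_ge0. Qed.

Lemma measurable_omega {R : realType} (b T : R) (D : set R) :
  measurable_fun D (fun s => omega b (T - s)).
Proof.
apply: measurable_funTS; apply: measurable_funM; last exact: measurable_cst.
apply: (measurableT_comp (measurable_powR (b - 1))).
by apply: measurable_funB.
Qed.

(** With T = t_n and ]c, d] the k-th mesh cell, this is [mesh_step] times [weight], that is, the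
    coefficient of the scheme without the division by the step. *)
Definition kernel_mass {R : realType} (alpha T c d : R) : R :=
  omega (2 - alpha) (T - c) - omega (2 - alpha) (T - d).

(** By Gamma(2 - alpha) = (1 - alpha) Gamma(1 - alpha), omega_(2-alpha) is a primitive of
    omega_(1-alpha); hence the scheme integrates the kernel exactly. *)
Lemma integral_omega {R : realType} (alpha T c d : R) :
  0 < alpha < 1 -> c < d -> d <= T ->
  (\int[lebesgue_measure]_(s in `]c, d]) (omega (1 - alpha) (T - s))%:E =
   (kernel_mass alpha T c d)%:E)%E.
Proof.
move=> /andP[a0 a1] cd dT.
have e01 : 0 < 1 - alpha < 1 by lra.
transitivity (((Gamma (1 - alpha))^-1)%:E *
    \int[lebesgue_measure]_(s in `]c, d]) ((T - s) `^ (1 - alpha - 1))%:E)%E.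
  rewrite -ge0_integralZl//=.
  - by under eq_integral do rewrite /omega mulrC EFinM.
  - apply: measurableT_comp => //; apply: measurable_funTS.
    apply: (measurableT_comp (measurable_powR _)).
    by apply: measurable_funB.
  - by move=> x _; rewrite lee_fin powR_ge0.
  - by rewrite lee_fin invr_ge0 Gamma_ge0.
rewrite integral_powR_kernel// -EFinM; congr EFin.
rewrite /kernel_mass /omega (_ : 2 - alpha - 1 = 1 - alpha); last by ring.
rewrite (_ : 2 - alpha = 1 - alpha + 1); last by ring.
by rewrite GammaD1// -mulrBl invfM; ring.
Qed.

(** * Piecewise constant quadrature of the fractional integral *)

Lemma omega_cell_error {R : realType} (alpha T c d e w : R) (v : R -> R) :
  0 < alpha < 1 -> c < d -> d <= T -> measurable_fun `]c, d] v ->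
  (forall s, c < s <= d -> `|w - v s| <= e) ->
  lebesgue_measure.-integrable `]c, d]
    (EFin \o (fun s => omega (1 - alpha) (T - s) * v s)) /\
  `|kernel_mass alpha T c d * w -
    \int[lebesgue_measure]_(s in `]c, d]) (omega (1 - alpha) (T - s) * v s)|
  <= kernel_mass alpha T c d * e.
Proof.
move=> a01 cd dT mv he.
set A := kernel_mass _ _ _ _.
have IA := integral_omega a01 cd dT.
have mo : measurable_fun `]c, d] (fun s => omega (1 - alpha) (T - s)).
  exact: measurable_omega.
have io : lebesgue_measure.-integrable `]c, d]
    (EFin \o (fun s => omega (1 - alpha) (T - s))).
  apply/integrableP; split; first by apply: measurableT_comp.
  under eq_integral do rewrite /= ger0_norm ?omega_ge0//.
  by rewrite IA ltry.
have iov (h : R -> R) M : measurable_fun `]c, d] h ->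
    (forall s, c < s <= d -> `|h s| <= M) ->
    lebesgue_measure.-integrable `]c, d]
      (EFin \o (fun s => omega (1 - alpha) (T - s) * h s)).
  move=> mh hM.
  have := @integrableMl _ _ _ _ _ _ _ _ io mh; apply => //.
  exists M; split; first exact: num_real.
  move=> x Mx s /=; rewrite in_itv/= => /hM /le_trans; apply; exact: ltW.
have iv : lebesgue_measure.-integrable `]c, d]
    (EFin \o (fun s => omega (1 - alpha) (T - s) * v s)).
  (* Staying within e of w bounds v by |w| + e, and a bounded factor keeps the kernel integrable. *)
  apply: (iov _ (`|w| + e)) => // s /he h.
  have -> : v s = w - (w - v s) by ring.
  by rewrite (le_trans (ler_normB _ _))// lerD2l.
split=> //.
(* Since the kernel has mass A, both A w and (below) A e become integrals against it, and the
   comparison is pointwise. *)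
have -> : A * w = \int[lebesgue_measure]_(s in `]c, d]) (omega (1 - alpha) (T - s) * w).
  by rewrite RintegralZr// /Rintegral IA.
rewrite -RintegralB//; last exact: (iov (cst w) `|w|).
have iB : lebesgue_measure.-integrable `]c, d] (EFin \o (fun s =>
    omega (1 - alpha) (T - s) * w - omega (1 - alpha) (T - s) * v s)).
  have -> : (fun s => omega (1 - alpha) (T - s) * w - omega (1 - alpha) (T - s) * v s)
      = (fun s => omega (1 - alpha) (T - s) * (w - v s)).
    by apply/funext => s; rewrite mulrBr.
  by apply: (iov _ e) => //; apply: measurable_funB.
apply: (le_trans (le_normr_Rintegral _ _)) => //.
have -> : A * e = \int[lebesgue_measure]_(s in `]c, d]) (omega (1 - alpha) (T - s) * e).
  by rewrite RintegralZr// /Rintegral IA.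
apply: le_Rintegral => //.
- exact: integrable_norm iB.
- exact: (iov (cst e) `|e|).
- move=> s /=; rewrite in_itv/= => hs.
  rewrite -mulrBr normrM (ger0_norm (omega_ge0 _ _)).
  by apply: ler_wpM2l; [exact: omega_ge0|exact: he].
Qed.

Lemma integrable_itvU {R : realType} (x y z : R) (g : R -> R) : x <= y -> y <= z ->
  lebesgue_measure.-integrable `]x, y] (EFin \o g) ->
  lebesgue_measure.-integrable `]y, z] (EFin \o g) ->
  lebesgue_measure.-integrable `]x, z] (EFin \o g) /\
  \int[lebesgue_measure]_(s in `]x, z]) g s =
  \int[lebesgue_measure]_(s in `]x, y]) g s + \int[lebesgue_measure]_(s in `]y, z]) g s.
Proof.
move=> xy yz i1 i2.
have U : `]x, z]%classic = `]x, y]%classic `|` `]y, z]%classic.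
  by rewrite -itv_bndbnd_setU// bnd_simp.
have D : [disjoint `]x, y]%classic & `]y, z]%classic].
  apply/disj_set2P/seteqP; split => // s [] /=; rewrite !in_itv/=.
  by move=> /andP[_ h1] /andP[h2 _]; move: h1; rewrite leNgt h2.
have i : lebesgue_measure.-integrable `]x, z] (EFin \o g).
  rewrite U; move/integrableP: i1 => [m1 f1]; move/integrableP: i2 => [m2 f2].
  have mU : measurable_fun (`]x, y]%classic `|` `]y, z]%classic) (EFin \o g).
    by apply/measurable_funU => //; exact: measurable_itv.
  apply/integrableP; split => //.
  rewrite ge0_integral_setU//=; first by rewrite lte_add_pinfty.
  exact: (measurableT_comp (@abse_measurable _ setT) mU).
split => //; rewrite U Rintegral_setU//; rewrite -U//.
Qed.

Lemma piecewise_constant_quadrature {R : realType} (alpha : R) (n : nat)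
    (p e : nat -> R) (v : R -> R) :
  0 < alpha < 1 -> p 0 = 0 -> (forall k, (k < n)%N -> p k < p k.+1) ->
  (forall k, (k < n)%N -> measurable_fun `]p k, p k.+1] v) ->
  (forall k s, (k < n)%N -> p k < s <= p k.+1 -> `|v (p k.+1) - v s| <= e k) ->
  `|\sum_(0 <= k < n) kernel_mass alpha (p n) (p k) (p k.+1) * v (p k.+1) -
    frac_int (1 - alpha) v (p n)|
  <= \sum_(0 <= k < n) kernel_mass alpha (p n) (p k) (p k.+1) * e k.
Proof.
move=> a01 p0 pS mv he.
pose A k := kernel_mass alpha (p n) (p k) (p k.+1).
have pmono i j : (i <= j)%N -> (j <= n)%N -> p i <= p j.
  elim: j => [|j IH]; first by rewrite leqn0 => /eqP->.
  rewrite leq_eqVlt => /predU1P[->//|ij] jn.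
  by rewrite (le_trans (IH ij (ltnW jn)))// ltW// pS.
pose g s := omega (1 - alpha) (p n - s) * v s.
(* Induction on the number m of cells, with the final time p n of the kernel frozen. Integrability
   is carried along because splitting the integral at p m requires it. *)
have key m : (m <= n)%N ->
  lebesgue_measure.-integrable `]0, p m] (EFin \o g) /\
  `|\sum_(0 <= k < m) A k * v (p k.+1) - \int[lebesgue_measure]_(s in `]0, p m]) g s|
  <= \sum_(0 <= k < m) A k * e k.
  elim: m => [_|m IH mn].
    rewrite p0 set_itvoc0 !big_geq// Rintegral_set0 subrr normr0; split => //.
    exact: integrable_set0.
  have [i1 h1] := IH (ltnW mn).
  have [i2 h2] := omega_cell_error a01 (pS _ mn) (pmono _ _ mn (leqnn _))
    (mv _ mn) (fun s hs => he m s mn hs).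
  have p0m : 0 <= p m by rewrite -p0 pmono// ltnW.
  have [i hU] := integrable_itvU p0m (ltW (pS _ mn)) i1 i2.
  split => //; rewrite !big_nat_recr//= hU.
  set S := \sum_(_ <= _ < _) _ in h1 *; set S' := \sum_(_ <= _ < _) _ in h1 *.
  set I1 := \int[_]_(_ in _) _ in h1 *; set I2 := \int[_]_(_ in _) _ in h2 *.
  have -> : S + A m * v (p m.+1) - (I1 + I2) = (S - I1) + (A m * v (p m.+1) - I2).
    by ring.
  by rewrite (le_trans (ler_normD _ _))// lerD.
have [i h] := key n (leqnn _).
rewrite /frac_int Rintegral_itv_bndo_bndc//.
apply: integrableS i => //.
by apply: subset_itvl; rewrite bnd_simp.
Qed.

(** * Discrete sums *)

Lemma powR_le_neg {R : realType} (p x y : R) : p <= 0 -> 0 < y -> y <= x ->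
  x `^ p <= y `^ p.
Proof.
move=> p0 y0 yx; have x0 : 0 < x by exact: lt_le_trans yx.
have -> : p = - (- p) by rewrite opprK.
rewrite powRN (powRN y) lef_pV2 ?posrE ?powR_gt0//.
by apply: ge0_ler_powR; rewrite ?nnegrE; lra.
Qed.

(* As p - 1 <= 0, y^p = y y^(p-1) >= y x^(p-1), also when y = 0. *)
Lemma powRB_le {R : realType} (p x y : R) : 0 < p <= 1 -> 0 <= y <= x ->
  x `^ p - y `^ p <= (x - y) * x `^ (p - 1).
Proof.
move=> /andP[p0 p1] /andP[y0 yx].
have [x0|x0] := leP x 0.
  have -> : x = 0 by lra.
  have -> : y = 0 by lra.
  by rewrite !subrr mul0r.
rewrite mulrBl mulr_powRB1 ?(ltW x0)// lerD2l lerN2.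
have [->|yn0] := eqVneq y 0; first by rewrite mul0r powR_ge0.
rewrite -[leRHS]mulr_powRB1//; apply: ler_wpM2l => //.
apply: powR_le_neg => //; first lra.
by rewrite lt_neqAle eq_sym yn0.
Qed.

(** The first factor is steep only near T and the second only near 0. Whichever is away from its
    singular end has slope at most its value at T / 2, by [powRB_le]; the other factor is left
    intact so that it can telescope later. *)
Lemma powR_increment_product {R : realType} (a T x y : R) :
  0 < a < 1 -> 0 <= y <= x -> x <= T ->
  ((T - y) `^ (1 - a) - (T - x) `^ (1 - a)) * (x `^ a - y `^ a) <=
  (x - y) * ((T / 2) `^ (- a) * (x `^ a - y `^ a) +
    (T / 2) `^ (a - 1) * ((T - y) `^ (1 - a) - (T - x) `^ (1 - a))).
Proof.
move=> /andP[a0 a1] /andP[y0 yx] xT.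
have [T0|T0] := leP T 0.
  have -> : x = 0 by lra.
  have -> : y = 0 by lra.
  by rewrite !subrr !mul0r.
set A := _ - _; set B := _ - _.
have A0 : 0 <= A.
  by rewrite subr_ge0; apply: ge0_ler_powR; rewrite ?nnegrE; lra.
have B0 : 0 <= B.
  by rewrite subr_ge0; apply: ge0_ler_powR; rewrite ?nnegrE; lra.
have h1 := powR_ge0 (T / 2) (- a); have h2 := powR_ge0 (T / 2) (a - 1).
have xy0 : 0 <= x - y by lra.
rewrite [leRHS]mulrDr; have [yT|yT] := leP y (T / 2).
- suff : A <= (x - y) * (T / 2) `^ (- a).
    move=> /(ler_wpM2r B0) /le_trans; apply; rewrite -mulrA lerDl.
    by rewrite !mulr_ge0.
  have := @powRB_le _ (1 - a) (T - y) (T - x); rewrite -/A.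
  rewrite (_ : T - y - (T - x) = x - y); last by ring.
  rewrite (_ : 1 - a - 1 = - a); last by ring.
  move=> h; apply: (le_trans (h _ _)); [lra|lra|].
  by apply: ler_wpM2l => //; apply: powR_le_neg; lra.
- suff : B <= (x - y) * (T / 2) `^ (a - 1).
    move=> /(ler_wpM2l A0) /le_trans; apply.
    by rewrite mulrC -mulrA lerDr !mulr_ge0.
  have h : 0 < a <= 1 by lra.
  apply: (le_trans (powRB_le h _)); first by rewrite y0.
  by apply: ler_wpM2l => //; apply: powR_le_neg; lra.
Qed.

(** The product equals 2^p for T > 0 and 0 for T = 0, so the bound does not depend on the final
    time. *)
Lemma powR_half_mul {R : realType} (p T : R) : 0 < p <= 1 -> 0 <= T ->
  (T / 2) `^ (- p) * T `^ p <= 2.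
Proof.
move=> /andP[p0 p1]; rewrite le_eqVlt => /predU1P[<-|T0].
  by rewrite powR0 ?gt_eqF// mulr0.
have -> : T `^ p = (T / 2) `^ p * 2 `^ p by rewrite -powRM ?divfK//; lra.
rewrite mulrA powRN mulVf ?mul1r; last by rewrite gt_eqF// powR_gt0; lra.
by apply: ler1_powR => //; rewrite ler1n.
Qed.

(** After [powR_increment_product] the two sums telescope to T^a and T^(1-a). Each cancels against
    its power of T / 2 up to a factor 2, whence 4, uniformly in T and n. *)
Lemma sum_powR_increments {R : realType} (a h : R) (n : nat) (s : nat -> R) :
  0 < a < 1 -> 0 <= h -> s 0 = 0 ->
  (forall k, (k < n)%N -> s k <= s k.+1 <= s k + h) ->
  \sum_(0 <= k < n) ((s n - s k) `^ (1 - a) - (s n - s k.+1) `^ (1 - a)) *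
     (s k.+1 `^ a - s k `^ a) <= 4 * h.
Proof.
move=> a01 h0 s0 sS; case/andP: (a01) => a0 a1.
have mono i j : (i <= j)%N -> (j <= n)%N -> s i <= s j.
  elim: j => [|j IH]; first by rewrite leqn0 => /eqP->.
  rewrite leq_eqVlt => /predU1P[->//|ij] jn.
  by case/andP: (sS _ jn) => h1 _; rewrite (le_trans (IH ij (ltnW jn))).
set T := s n.
have T0 : 0 <= T by rewrite -s0 mono.
pose A k := (T - s k) `^ (1 - a) - (T - s k.+1) `^ (1 - a).
pose B k := s k.+1 `^ a - s k `^ a.
have bnd k : (k < n)%N -> A k * B k <=
    h * ((T / 2) `^ (- a) * B k + (T / 2) `^ (a - 1) * A k).
  move=> kn; have /andP[h1 h2] := sS _ kn.
  have h3 : 0 <= s k by rewrite -s0 mono// ltnW.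
  have h4 : s k.+1 <= T by exact: mono.
  apply: (le_trans (@powR_increment_product _ a T (s k.+1) (s k) a01 _ h4)).
    by rewrite h3.
  apply: ler_wpM2r; last lra.
  by rewrite addr_ge0// mulr_ge0 ?powR_ge0// subr_ge0;
    apply: ge0_ler_powR; rewrite ?nnegrE; lra.
rewrite big_nat; apply: (le_trans (ler_sum _ _)) => [k /= kn|]; first exact: bnd.
rewrite -big_nat -mulr_sumr big_split/= -!mulr_sumr.
have -> : \sum_(0 <= k < n) B k = T `^ a.
  by rewrite telescope_sumr// s0 powR0 ?subr0// gt_eqF.
have -> : \sum_(0 <= k < n) A k = T `^ (1 - a).
  under eq_bigr => k _ do rewrite /A -opprB.
  rewrite sumrN telescope_sumr// s0 subr0 -/T subrr powR0 ?sub0r ?opprK//.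
  by rewrite gt_eqF// subr_gt0.
have := @powR_half_mul _ a T; have := @powR_half_mul _ (1 - a) T.
rewrite opprB => h1 h2.
rewrite mulrC; apply: ler_wpM2r => //.
have {}h1 := h1 _ T0; have {}h2 := h2 _ T0.
by rewrite (_ : 4 = 2 + 2); [apply: lerD; [apply: h2|apply: h1]; lra|lra].
Qed.

(** * The symmetric graded mesh *)

(* Comparing with a natural exponent q reduces the bound to Bernoulli's
   inequality for y / x. *)
Lemma powRB_le01 {R : realType} (r x y : R) (q : nat) :
  1 <= r -> r <= q%:R -> 0 <= y <= x -> x <= 1 ->
  x `^ r - y `^ r <= q%:R * (x - y).
Proof.
move=> r1 rq /andP[y0 yx] x1.
have [->|yn0] := eqVneq y 0.
  rewrite powR0 ?gt_eqF//; last lra.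
  rewrite !subr0; have [->|xn0] := eqVneq x 0.
    by rewrite powR0 ?mulr0// gt_eqF//; lra.
  have q1 : 1 <= q%:R :> R by exact: le_trans rq.
  have h : x `^ r <= x by apply: ge1r_powR => //; rewrite x1 andbT lt_neqAle eq_sym xn0; lra.
  by rewrite (le_trans h)// ler_peMl//; lra.
have {yn0}y0 : 0 < y by rewrite lt_neqAle eq_sym yn0.
have x0 : 0 < x by lra.
pose z := y / x.
have z0 : 0 < z by rewrite divr_gt0.
have z1 : z <= 1 by rewrite ler_pdivrMr ?mul1r.
have bern (n : nat) : 1 - z ^+ n <= n%:R * (1 - z).
  elim: n => [|n IH]; first by rewrite expr0 subrr mul0r.
  have hz : 0 <= z ^+ n <= 1 by rewrite exprn_ge0 ?exprn_ile1// ltW.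
  rewrite exprS -natr1 mulrDl mul1r; nra.
have hz : z ^+ q <= z `^ r.
  by rewrite -powR_mulrn ?(ltW z0)//; apply: ger_powR => //; rewrite z0.
have hx : x `^ r <= x by apply: ge1r_powR => //; rewrite x0.
have -> : y = x * z by rewrite /z mulrC divfK// gt_eqF.
rewrite powRM ?(ltW x0) ?(ltW z0)//.
have h1 := bern q.
have h2 : 0 <= 1 - z ^+ q by rewrite subr_ge0 exprn_ile1// ltW.
have h3 := powR_ge0 x r.
(* The chain is x^r (1 - z^r) <= x^r (1 - z^q) <= x (1 - z^q) <= q x (1 - z), where x z = y. *)
have -> : x `^ r - x `^ r * z `^ r = x `^ r * (1 - z `^ r) by ring.
apply: (@le_trans _ _ (x `^ r * (1 - z ^+ q))).
  by apply: ler_wpM2l => //; lra.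
apply: (@le_trans _ _ (x * (1 - z ^+ q))).
  by apply: ler_wpM2r.
have -> : q%:R * (x - x * z) = x * (q%:R * (1 - z)) by ring.
by apply: ler_wpM2l => //; exact: ltW.
Qed.

(** Position of the m-th node within one period of length tau, rescaled to [0, 1], for m from 0 to
    2N. For N > 0 both formulas give 1/2 at m = N. *)
Definition mesh_profile {R : realType} (r : R) (N m : nat) : R :=
  if (m <= N)%N then (m%:R / N%:R) `^ r / 2
  else 1 - ((2 * N - m)%:R / N%:R) `^ r / 2.

Lemma mesh_profile_reflected {R : realType} (r : R) (N m : nat) : (0 < N)%N ->
  (N <= m)%N -> mesh_profile r N m = 1 - ((2 * N - m)%:R / N%:R) `^ r / 2.
Proof.
move=> N0; rewrite leq_eqVlt => /predU1P[<-|Nm].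
  rewrite /mesh_profile leqnn (_ : (2 * N - N = N)%N); last lia.
  by rewrite divff ?powR1 ?pnatr_eq0 -?lt0n//; lra.
by rewrite /mesh_profile leqNgt Nm.
Qed.

Lemma mesh_profile0 {R : realType} (r : R) (N : nat) : 0 < r -> mesh_profile r N 0 = 0.
Proof. by move=> r0; rewrite /mesh_profile leq0n mul0r powR0 ?mul0r// gt_eqF. Qed.

(** Each step is half the difference of two consecutive values of (i/N)^r, to which [powRB_le01]
    applies. On the right half the reflected index is i = 2N - m - 1. *)
Lemma mesh_profile_step {R : realType} (r : R) (N m q : nat) : (0 < N)%N ->
  1 <= r -> r <= q%:R -> (m < 2 * N)%N ->
  0 < mesh_profile r N m.+1 - mesh_profile r N m <= q%:R / N%:R.
Proof.
move=> N0 r1 rq m2N.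
have N0' : 0 < N%:R :> R by rewrite ltr0n.
have key (i : nat) : (i < N)%N ->
    0 < (i.+1%:R / N%:R) `^ r - (i%:R / N%:R) `^ r <= (q%:R / N%:R : R).
  move=> iN.
  have i1 : i%:R / N%:R < i.+1%:R / N%:R :> R by rewrite ltr_pM2r ?invr_gt0// ltr_nat.
  have i2 : i.+1%:R / N%:R <= 1 :> R by rewrite ler_pdivrMr// mul1r ler_nat.
  have i0 : 0 <= i%:R / N%:R :> R by rewrite divr_ge0.
  rewrite subr_gt0 gt0_ltr_powR ?nnegrE//=; [|lra..].
  apply: (le_trans (powRB_le01 r1 rq _ i2)); first by rewrite i0 ltW.
  by rewrite -mulrBl -natrB// subSnn mul1r.
have qN : 0 <= q%:R / N%:R :> R by rewrite divr_ge0.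
have [mN|Nm] := ltnP m N.
  have /andP[h1 h2] := key _ mN.
  rewrite /mesh_profile mN (ltnW mN) -mulrBl; lra.
rewrite !mesh_profile_reflected//; last exact: leqW.
have /key : (2 * N - m.+1 < N)%N by lia.
rewrite (_ : (2 * N - m.+1).+1 = 2 * N - m)%N; last lia.
by move=> /andP[h1 h2]; lra.
Qed.

Lemma mesh_profile01 {R : realType} (r : R) (N m : nat) : (0 < N)%N -> 1 <= r ->
  (m <= 2 * N)%N -> 0 <= mesh_profile r N m <= 1.
Proof.
move=> N0 r1 m2N.
have N0' : 0 < N%:R :> R by rewrite ltr0n.
have key (i : nat) : (i <= N)%N -> 0 <= (i%:R / N%:R) `^ r <= (1 : R).
  move=> iN; rewrite powR_ge0/=.
  rewrite [leRHS](_ : 1 = 1 `^ r); last by rewrite powR1.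
  apply: ge0_ler_powR; rewrite ?nnegrE ?divr_ge0//; first lra.
  by rewrite ler_pdivrMr// mul1r ler_nat.
have [mN|Nm] := leqP m N.
  by have := key _ mN; rewrite /mesh_profile mN; lra.
have /key : (2 * N - m <= N)%N by lia.
rewrite mesh_profile_reflected//; last exact: ltnW.
lra.
Qed.

(** One formula for all periods, counted so that j = 0 is the history [-tau, 0]; the shift by 2N
    turns the integer indices of the mesh into naturals. *)
Lemma mesh_nodeE {R : realType} (tau r : R) (K N : nat) (t : int -> R) (j m : nat) :
  0 < r -> (0 < N)%N -> symmetric_graded_mesh tau r K N t -> (j <= K)%N ->
  (m <= 2 * N)%N ->
  t ((2 * j * N + m)%N%:Z - 2 * N%:Z) = (j%:R - 1) * tau + tau * mesh_profile r N m.
Proof.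
move=> r0 N0 [tlast H] jK m2N.
have N0' : N%:R != 0 :> R by rewrite pnatr_eq0 -lt0n.
(* The left end of a period is not covered by its own two formulas: it is the prescribed t_(-2N) =
   -tau when j = 0, and the right end of the preceding period otherwise. *)
have [m0|m0] := posnP m.
  rewrite m0 mesh_profile0// mulr0 addr0 addn0.
  case: j jK => [_|j jK].
    rewrite muln0 mul0n sub0r tlast; lra.
  have [_ h] := H j (2 * j.+1 * N - 2 * N)%N%:Z (ltnW jK).
  rewrite (_ : (2 * j.+1 * N)%N%:Z - 2 * N%:Z = (2 * j.+1 * N - 2 * N)%N%:Z); last lia.
  rewrite h; [|lia|lia].
  rewrite (_ : 2 * j%:Z * N%:Z - (2 * j.+1 * N - 2 * N)%N%:Z = 0); last lia.
  rewrite mul0r powR0 ?gt_eqF// -natr1; lra.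
have [H1 H2] := H j ((2 * j * N + m)%N%:Z - 2 * N%:Z) jK.
have [mN|Nm] := ltnP m N.
  rewrite H1; [|lia|lia].
  rewrite (_ : _ - 2 * N%:Z - _ = m%:Z); last lia.
  rewrite /mesh_profile (ltnW mN) pmulrn; lra.
rewrite H2; [|lia|lia].
rewrite (_ : _ - (_ - 2 * N%:Z) = (2 * N - m)%N%:Z); last lia.
rewrite mesh_profile_reflected// pmulrn; lra.
Qed.

(** Euclidean division of k by 2N yields the period j of the cell and its position m there. As m <
    2N, both end points lie in the same closed period. *)
Lemma mesh_cell {R : realType} (tau r : R) (K N q k : nat) (t : int -> R) :
  0 < tau -> 1 <= r -> r <= q%:R -> (0 < N)%N -> symmetric_graded_mesh tau r K N t ->
  (k < 2 * K * N)%N ->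
  [/\ exists2 j, (j < K)%N & j%:R * tau <= t k%:Z /\ t k.+1%:Z <= j.+1%:R * tau,
      t k%:Z < t k.+1%:Z <= t k%:Z + tau * (q%:R / N%:R) &
      t (k.+1%:Z - 2 * N%:Z) = t k.+1%:Z - tau].
Proof.
move=> tau0 r1 rq N0 tm kKN.
have r0 : 0 < r by lra.
pose j := (k %/ (2 * N))%N; pose m := (k %% (2 * N))%N.
have kE : k = (2 * j * N + m)%N.
  by rewrite {1}(divn_eq k (2 * N)) -/j -/m; lia.
have m2N : (m < 2 * N)%N by rewrite ltn_mod; lia.
have jK : (j < K)%N by rewrite ltn_divLR; lia.
(* Reading [mesh_nodeE] in period j + 1 gives the node itself; reading it in period j gives the
   delayed node, exactly tau earlier. *)
have e0 i : (i <= 2 * N)%N -> t (2 * j * N + i)%N%:Z = j%:R * tau + tau * mesh_profile r N i.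
  move=> hi; have := mesh_nodeE r0 N0 tm jK hi.
  rewrite (_ : _ - _ = (2 * j * N + i)%N%:Z); last lia.
  by move=> ->; rewrite -natr1 addrK.
have e1 i : (i <= 2 * N)%N -> t ((2 * j * N + i)%N%:Z - 2 * N%:Z) =
    j%:R * tau + tau * mesh_profile r N i - tau.
  by move=> hi; rewrite (mesh_nodeE r0 N0 tm (ltnW jK) hi); lra.
have s1 := mesh_profile_step N0 r1 rq m2N.
have s2 := mesh_profile01 N0 r1 m2N.
have s3 := mesh_profile01 N0 r1 (ltnW m2N).
have a0 := e0 _ (ltnW m2N); have a1 := e0 _ m2N; have a2 := e1 _ m2N.
have -> : k.+1 = (2 * j * N + m.+1)%N by rewrite kE addnS.
rewrite [in t k%:Z]kE a0 a1 a2.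
set x := mesh_profile r N m in s1 s3 *; set y := mesh_profile r N m.+1 in s1 s2 *.
have h1 : 0 <= tau * x by rewrite mulr_ge0//; [lra|case/andP: s3].
have h2 : tau * y <= tau by rewrite ger_pMr//; case/andP: s2.
have /andP[h3 h4] : 0 < tau * (y - x) <= tau * (q%:R / N%:R).
  by case/andP: s1 => g1 g2; rewrite mulr_gt0//= ler_wpM2l// ltW.
split => //; last by lra.
by exists j => //; rewrite -natr1; split; lra.
Qed.

(** Since t_1 = (tau / 2) N^(-r), the target rate rho_1^(1/r) is an exact multiple of 1/N, whatever
    the grading. *)
Lemma mesh_step1 {R : realType} (tau r : R) (K N : nat) (t : int -> R) :
  0 < tau -> 1 <= r -> (0 < K)%N -> (2 <= N)%N -> symmetric_graded_mesh tau r K N t ->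
  t 0 = 0 /\ mesh_step t 1 `^ r^-1 = (tau / 2) `^ r^-1 / N%:R.
Proof.
move=> tau0 r1 K0 N2 tm.
have r0 : 0 < r by lra.
have N0 : (0 < N)%N by exact: ltnW.
have N0' : 0 < N%:R :> R by rewrite ltr0n.
have := @mesh_nodeE _ _ _ _ _ _ 1 0 r0 N0 tm K0 isT.
rewrite mesh_profile0// mulr0 addr0 subrr mul0r (_ : _ - _ = 0); last lia.
move=> t0; split=> //.
have := @mesh_nodeE _ _ _ _ _ _ 1 1 r0 N0 tm K0.
rewrite /mesh_profile N0 subrr mul0r add0r (_ : _ - _ = 1); last lia.
move=> h; rewrite /mesh_step subrr t0 subr0 h; last lia.
have -> : tau * ((1 / N%:R) `^ r / 2) = tau / 2 * (1 / N%:R) `^ r by ring.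
rewrite powRM ?powR_ge0//; last lra.
by rewrite -powRrM mulfV ?gt_eqF// powRr1 ?mul1r// invr_ge0 ltW.
Qed.

(** * Weak derivatives *)

(** Squared positive parts are the C^1 building blocks from which the test functions below are
    assembled. *)
Lemma is_derive_sqr_pospart {R : realType} (x : R) :
  is_derive x 1 (fun t : R => Num.max 0 t ^+ 2) (2 * Num.max 0 x).
Proof.
have [x0|x0|<-] := ltgtP 0 x.
- apply: (@near_eq_is_derive _ _ _ (fun t : R => t ^+ 2)).
    near=> t; rewrite max_r//; near: t; apply: filterS (lt_nbhsr x0) => t; exact: ltW.
  apply/is_derive1_caratheodory; exists (fun t => t + x); split.
  + by move=> z; ring.
  + by apply: cvgD; [exact: cvg_id|exact: cvg_cst].
  + by ring.
- apply: (@near_eq_is_derive _ _ _ (cst 0)).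
    near=> t; rewrite max_l ?expr0n//; near: t; apply: filterS (lt_nbhsl x0) => t; exact: ltW.
  rewrite mulr0; exact: is_derive_cst.
(* At 0 the Caratheodory slope is the positive part itself, as max(0, z)^2 = max(0, z) z. *)
- apply/is_derive1_caratheodory; exists (fun t => Num.max 0 t); split.
  + move=> z; rewrite maxxx expr0n/= !subr0 expr2.
    by have [z0|z0] := leP z 0; rewrite ?mul0r.
  + apply: (@continuous_max _ _ (cst 0) id); [exact: cvg_cst|exact: cvg_id].
  + by rewrite maxxx mulr0.
Unshelve. all: by end_near. Qed.

(* [tent e] is a continuous bump of unit mass supported in [[0, 2 e]], and
   [ramp e] is its primitive. *)
Definition tent {R : realType} (e t : R) : R :=
  (Num.max 0 t - 2 * Num.max 0 (t - e) + Num.max 0 (t - 2 * e)) / e ^+ 2.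

Definition ramp {R : realType} (e t : R) : R :=
  (Num.max 0 t ^+ 2 - 2 * Num.max 0 (t - e) ^+ 2 + Num.max 0 (t - 2 * e) ^+ 2)
  / (2 * e ^+ 2).

Lemma is_derive_ramp {R : realType} (e y t : R) : e != 0 ->
  is_derive t 1 (fun s => ramp e (s - y)) (tent e (t - y)).
Proof.
move=> e0.
have d (z : R) : is_derive t 1 (fun s : R => Num.max 0 (s - z) ^+ 2) (2 * Num.max 0 (t - z)).
  have := @is_derive1_comp _ (fun t : R => Num.max 0 t ^+ 2) (shift (- z)) t _ 1
    (is_derive_sqr_pospart _) (is_derive_shift _ _ _).
  by rewrite mulr1.
have -> : (fun s => ramp e (s - y)) = (2 * e ^+ 2)^-1 \*:
   (((fun s => Num.max 0 (s - y) ^+ 2) - 2 \*: (fun s => Num.max 0 (s - (y + e)) ^+ 2))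
     + (fun s => Num.max 0 (s - (y + 2 * e)) ^+ 2)).
  apply/funext => s.
  transitivity ((2 * e ^+ 2)^-1 * (Num.max 0 (s - y) ^+ 2 -
    2 * Num.max 0 (s - (y + e)) ^+ 2 + Num.max 0 (s - (y + 2 * e)) ^+ 2)) => //.
  by rewrite /ramp !opprD !addrA mulrC.
have -> : tent e (t - y) = (2 * e ^+ 2)^-1 *: ((2 * Num.max 0 (t - y) -
    2 *: (2 * Num.max 0 (t - (y + e)))) + 2 * Num.max 0 (t - (y + 2 * e))).
  rewrite /tent !opprD !addrA /GRing.scale/=; field; exact: e0.
apply: is_deriveZ.
Qed.

Lemma continuous_tent {R : realType} (e y : R) : continuous (fun t => tent e (t - y)).
Proof.
have d (z : R) : continuous (fun s : R => Num.max 0 (s - z)).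
  move=> t; apply: (@continuous_max _ _ (cst 0) (fun s => s - z)); first exact: cvg_cst.
  by apply: cvgB; [exact: cvg_id|exact: cvg_cst].
have -> : (fun t => tent e (t - y)) = (fun t => (Num.max 0 (t - y) -
   2 * Num.max 0 (t - (y + e)) + Num.max 0 (t - (y + 2 * e))) / e ^+ 2).
  by apply/funext => s; rewrite /tent !opprD !addrA.
move=> t; apply: cvgM; last exact: cvg_cst.
apply: cvgD; last exact: d.
apply: cvgB; first exact: d.
by apply: cvgM; [exact: cvg_cst|exact: d].
Qed.

Lemma tent_ge0 {R : realType} (e t : R) : 0 < e -> 0 <= tent e t.
Proof.
move=> e0; rewrite divr_ge0 ?sqr_ge0//.
by case: (leP t 0) => ?; case: (leP (t - e) 0) => ?; case: (leP (t - 2 * e) 0) => ?; lra.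
Qed.

Lemma tent_out {R : realType} (e t : R) : 0 < e -> ~~ (0 <= t <= 2 * e) -> tent e t = 0.
Proof.
move=> e0 ht; rewrite /tent; apply/eqP; rewrite mulf_eq0; apply/orP; left; apply/eqP.
move: ht; rewrite negb_and -!ltNge => /orP[] ht;
by case: (leP t 0) => ?; case: (leP (t - e) 0) => ?; case: (leP (t - 2 * e) 0) => ?; lra.
Qed.

Lemma ramp_le0 {R : realType} (e t : R) : 0 < e -> t <= 0 -> ramp e t = 0.
Proof.
move=> e0 ht; rewrite /ramp !max_l; [|lra..].
by rewrite expr0n/= mulr0 subrr addr0 mul0r.
Qed.

Lemma ramp_ge {R : realType} (e t : R) : 0 < e -> 2 * e <= t -> ramp e t = 1.
Proof.
move=> e0 ht; rewrite /ramp !max_r; [|lra..].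
by field; rewrite gt_eqF.
Qed.

Lemma ramp01 {R : realType} (e t : R) : 0 < e -> 0 <= ramp e t <= 1.
Proof.
move=> e0; have e20 : 0 < 2 * e ^+ 2 by rewrite mulr_gt0// exprn_gt0.
rewrite /ramp divr_ge0 ?(ltW e20)//= ?ler_pdivrMr// ?mul1r;
by case: (leP t 0) => ?; case: (leP (t - e) 0) => ?; case: (leP (t - 2 * e) 0) => ?; nra.
Qed.

Lemma within_continuous_dist {R : realType} (A : set R) (f : R -> R) (x eps : R) :
  {within A, continuous f} -> A x -> 0 < eps ->
  exists2 e, 0 < e & forall t, A t -> `|t - x| < e -> `|f t - f x| < eps.
Proof.
move=> /subspace_continuousP/(_ x) h Ax eps0.
have /cvgrPdist_lt/(_ _ eps0) := h Ax.
rewrite near_withinE => /nbhs_ballP[e /= e0 he].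
exists e => // t At te; rewrite distrC; apply: he => //.
by rewrite /ball/= distrC.
Qed.

Lemma integral_tent {R : realType} (c d e y : R) : 0 < e -> c < y -> y + 2 * e < d ->
  \int[lebesgue_measure]_(t in `[c, d]) tent e (t - y) = 1.
Proof.
move=> e0 cy yd; rewrite /Rintegral.
have en : e != 0 by rewrite gt_eqF.
have dr (t : R) := @is_derive_ramp _ e y t en.
have cr (t : R) : {for t, continuous (fun s => ramp e (s - y))}.
  by apply: differentiable_continuous; apply/derivable1_diffP; have [] := dr t.
rewrite (@continuous_FTC2 _ _ (fun s => ramp e (s - y)))//.
- by rewrite ramp_ge//=; [rewrite ramp_le0// ?subr0//; lra|lra].
- lra.
- by apply: continuous_subspaceT => t; exact: continuous_tent.
- split.
  + by move=> t _; have [] := dr t.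
  + by apply: cvg_at_right_filter; exact: cr.
  + by apply: cvg_at_left_filter; exact: cr.
- by move=> t _; rewrite derive1E; have [_ ->] := dr t.
Qed.

(** The tent at y is a mollifier: the integral is a weighted mean of v over [y, y + 2e], where
    continuity keeps v within eps of v y. *)
Lemma tent_integral_near {R : realType} (c d y eps : R) (v : R -> R) :
  {within `[c, d], continuous v} -> c < y < d -> 0 < eps ->
  exists2 e0, 0 < e0 & forall e, 0 < e -> e < e0 ->
    `|\int[lebesgue_measure]_(t in `[c, d]) (v t * tent e (t - y)) - v y| <= eps.
Proof.
move=> cv /andP[cy yd] eps0.
have ycd : `[c, d]%classic y by rewrite /= in_itv/=; lra.
have [e1 e10 he1] := within_continuous_dist cv ycd eps0.
(* The support [y, y + 2e] must stay within distance e1 of y, by the first term, and inside [c, d],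
   by the second. *)
exists (Num.min (e1 / 2) ((d - y) / 2)); first by rewrite lt_min; apply/andP; split; lra.
move=> e e0; rewrite lt_min => /andP[ee1 eyd].
have icont (f : R -> R) : {within `[c, d], continuous f} ->
    lebesgue_measure.-integrable `[c, d] (EFin \o f).
  by move=> cf; apply: continuous_compact_integrable => //; exact: segment_compact.
have ct : {within `[c, d], continuous (fun t => tent e (t - y))}.
  by apply: continuous_subspaceT => t; exact: continuous_tent.
have cM (f : R -> R) : {within `[c, d], continuous f} ->
    {within `[c, d], continuous (fun t => f t * tent e (t - y))}.
  by move=> cf t; apply: cvgM; [exact: cf|exact: ct].
have cc (k : R) : {within `[c, d], continuous (fun=> k : R)}.
  by apply: continuous_subspaceT => t; exact: cvg_cst.
have one : \int[lebesgue_measure]_(t in `[c, d]) tent e (t - y) = 1.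
  by apply: integral_tent => //; lra.
have cst1 (k : R) : \int[lebesgue_measure]_(t in `[c, d]) (k * tent e (t - y)) = k.
  by rewrite RintegralZl ?one ?mulr1//; exact: icont.
rewrite -[X in _ - X]cst1 -RintegralB//; [|by apply: icont; apply: cM..].
have cD : {within `[c, d], continuous (fun t => v t * tent e (t - y) - v y * tent e (t - y))}.
  by move=> t; apply: cvgB; apply: cM.
apply: (le_trans (le_normr_Rintegral _ _)) => //; first exact: icont.
rewrite -[leRHS]cst1; apply: le_Rintegral => //.
- by apply: integrable_norm; exact: icont.
- by apply: icont; apply: cM.
- move=> t tcd; rewrite -mulrBl normrM (ger0_norm (tent_ge0 _ e0)).
  have [hin|hout] := boolP (0 <= t - y <= 2 * e).
    apply: ler_wpM2r; first exact: tent_ge0.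
    by apply/ltW/he1 => //; rewrite ger0_norm; lra.
  by rewrite tent_out// !mulr0.
Qed.

(* Test with psi = ramp (. - y) - ramp (. - z): as e tends to 0, the integral of
   v psi' tends to v y - v z, while |psi| <= 1 vanishes outside [y, z + 2 e]. *)
Lemma weak_derivative_Linfty_lipschitz_oo {R : realType} (c d M : R) (v : R -> R) (y z : R) :
  {within `[c, d], continuous v} -> weak_derivative_Linfty c d M v ->
  c < y -> y <= z -> z < d -> `|v z - v y| <= `|M| * (z - y).
Proof.
move=> cv [g [mg gM wg]] cy; rewrite le_eqVlt => /predU1P[<-|yz] zd.
  by rewrite !subrr normr0 mulr0.
apply/ler_addgt0Pr => eps' eps'0.
(* Error budget: eps for the mollification at y, eps at z, and 2 |M| e <= 2 |M| eps because the
   support of psi exceeds [y, z] by 2e. *)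
pose eps := eps' / (2 + 2 * `|M|).
have eps0 : 0 < eps by rewrite divr_gt0// ltr_wpDr// mulr_ge0.
have [|e1 e10 he1] := tent_integral_near (y := y) cv _ eps0; first by lra.
have [|e2 e20 he2] := tent_integral_near (y := z) cv _ eps0; first by lra.
(* The halves make e strictly smaller than e1 and e2; (d - z) / 3 gives z + 2e < d, so that psi has
   compact support in ]c, d[. *)
pose e := Num.min (Num.min (e1 / 2) (e2 / 2)) (Num.min eps ((d - z) / 3)).
have e0 : 0 < e by rewrite !lt_min !divr_gt0//; lra.
have : e <= e by [].
rewrite {2}/e !le_min => /andP[/andP[h1 h2] /andP[h3 h4]].
have {he1}k1 := he1 e e0 ltac:(lra); have {he2}k2 := he2 e e0 ltac:(lra).
pose psi t := ramp e (t - y) - ramp e (t - z).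
have en : e != 0 by rewrite gt_eqF.
have dpsi (t : R) : is_derive t 1 psi (tent e (t - y) - tent e (t - z)).
  by apply: is_deriveB; exact: is_derive_ramp.
have dpsiE : derive1 psi = (fun t => tent e (t - y) - tent e (t - z)).
  by apply/funext => t; rewrite derive1E; have [_ ->] := dpsi t.
have psi_out t : t \notin `[y, z + 2 * e] -> psi t = 0.
  rewrite in_itv/= negb_and -!ltNge => /orP[] ht.
    by rewrite /psi !ramp_le0 ?subrr//; lra.
  by rewrite /psi !ramp_ge ?subrr//; lra.
have psi1 t : `|psi t| <= 1.
  rewrite ler_norml /psi; have /andP[] := ramp01 (t - y) e0; have /andP[] := ramp01 (t - z) e0.
  by move=> *; apply/andP; split; lra.
have test : test_function c d psi.
  split.
  - by move=> t; have [] := dpsi t.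
  - by rewrite dpsiE => t; apply: cvgB; exact: continuous_tent.
  - by exists y, (z + 2 * e); split => //; lra.
have icont (f : R -> R) : {within `[c, d], continuous f} ->
    lebesgue_measure.-integrable `[c, d] (EFin \o f).
  by move=> cf; apply: continuous_compact_integrable => //; exact: segment_compact.
have cM x : {within `[c, d], continuous (fun t => v t * tent e (t - x))}.
  move=> t; apply: cvgM; first exact: cv.
  have h : {within `[c, d], continuous (fun t => tent e (t - x))}.
    by apply: continuous_subspaceT => s; exact: continuous_tent.
  exact: h.
have cD : {within `[c, d], continuous (fun t => v t * tent e (t - y) - v t * tent e (t - z))}.
  by move=> t; apply: cvgB; exact: cM.
have LHS : \int[lebesgue_measure]_(t in `]c, d[) (v t * derive1 psi t) =
    \int[lebesgue_measure]_(t in `[c, d]) (v t * tent e (t - y)) -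
    \int[lebesgue_measure]_(t in `[c, d]) (v t * tent e (t - z)).
  rewrite -RintegralB//; [|by apply: icont; exact: cM..].
  rewrite dpsiE; under eq_Rintegral do rewrite mulrBr.
  have iD := icont _ cD.
  rewrite Rintegral_itv_bndo_bndc; last first.
    by apply: integrableS iD => //; apply: subset_itv; rewrite bnd_simp.
  rewrite Rintegral_itv_obnd_cbnd//.
  by apply: integrableS iD => //; apply: subset_itv; rewrite bnd_simp.
have mpsi D : measurable_fun D psi.
  apply: measurable_funTS; apply: continuous_measurable_fun => t.
  by apply: differentiable_continuous; apply/derivable1_diffP; have [] := dpsi t.
have mgpsi : measurable_fun `]c, d[ (fun t => g t * psi t) by exact: measurable_funM.
pose S := `[y, z + 2 * e]%classic.
(* The bound on g holds only almost everywhere, so g psi is compared a.e. with |M| times the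
   indicator of the support. Finiteness then also yields the integrability of g psi. *)
have bnd : (\int[lebesgue_measure]_(t in `]c, d[) `|(g t * psi t)%:E| <=
    (`|M| * (z + 2 * e - y))%:E)%E.
  apply: (@le_trans _ _ (\int[lebesgue_measure]_(t in `]c, d[) (`|M| * \1_S t)%:E)%E).
    apply: ae_ge0_le_integral => //.
    - by apply: measurableT_comp => //; apply: measurableT_comp.
    - by apply: measurableT_comp => //; apply: measurable_funM => //; apply: measurable_indic; exact: measurable_itv.
    - case: gM => N [mN N0 hN]; exists N; split => // t; apply: contra_notP => tN tcd.
      have {hN tN}ht : t \in `]c, d[ -> `|g t| <= M by apply: contra_notP tN => /hN.
      rewrite lee_fin normrM indicE.
      have [tS|tS] := boolP (t \in S).
        rewrite mulr1; apply: (@le_trans _ _ (`|g t| * 1)); first exact: ler_wpM2l.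
        rewrite mulr1; apply: le_trans (ler_norm _); exact: ht.
      rewrite mulr0 psi_out ?normr0 ?mulr0//.
      by apply: contra tS => h; rewrite inE.
  under eq_integral do rewrite EFinM.
  rewrite ge0_integralZl//=.
  - rewrite integral_indic//=; last exact: measurable_itv.
    rewrite setIidl; last by apply: subset_itv; rewrite bnd_simp; lra.
    rewrite lebesgue_measure_itv/= lte_fin.
    rewrite (_ : y < z + 2 * e); last lra.
    by rewrite -EFinB -EFinM.
  - by apply: measurableT_comp => //; apply: measurable_indic; exact: measurable_itv.
have igpsi : lebesgue_measure.-integrable `]c, d[ (EFin \o (fun t => g t * psi t)).
  apply/integrableP; split; first exact: measurableT_comp.
  exact: le_lt_trans bnd (ltry _).
have RHS : `|\int[lebesgue_measure]_(t in `]c, d[) (g t * psi t)| <= `|M| * (z + 2 * e - y).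
  apply: (le_trans (le_normr_Rintegral _ igpsi)) => //.
  rewrite -lee_fin /Rintegral fineK//.
  rewrite ge0_fin_numE; first exact: le_lt_trans bnd (ltry _).
  by apply: integral_ge0 => t _; rewrite lee_fin.
move: RHS; have /(congr1 -%R) := wg _ test; rewrite opprK LHS => <-.
set a := \int[_]_(_ in _) _ in k1 *; set b := \int[_]_(_ in _) _ in k2 *.
move=> H.
have -> : v z - v y = - (a - b) + (a - v y) - (b - v z) by ring.
have hM : (2 + 2 * `|M|) * eps = eps'.
  by rewrite /eps mulrC divfK// gt_eqF// ltr_wpDr// mulr_ge0.
have hMe : `|M| * e <= `|M| * eps by apply: ler_wpM2l => //; lra.
apply: (le_trans (ler_normB _ _)); apply: (@le_trans _ _ (`|- (a - b)| + `|a - v y| + `|b - v z|)).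
  by rewrite lerD2r ler_normD.
lra.
Qed.

(** Test functions only see the open interval; the right end point is reached by letting z tend to d
    and using continuity of v. *)
Lemma weak_derivative_Linfty_lipschitz {R : realType} (c d M : R) (v : R -> R) (y z : R) :
  {within `[c, d], continuous v} -> weak_derivative_Linfty c d M v ->
  c < y -> y <= z -> z <= d -> `|v z - v y| <= `|M| * (z - y).
Proof.
move=> cv wv cy yz; rewrite le_eqVlt => /predU1P[zd|]; last first.
  exact: weak_derivative_Linfty_lipschitz_oo.
rewrite zd in yz *; move: yz; rewrite le_eqVlt => /predU1P[<-|yd].
  by rewrite !subrr normr0 mulr0.
apply/ler_addgt0Pr => eps eps0.
have dcd : `[c, d]%classic d by rewrite /= in_itv/=; lra.
have [e e0 he] := within_continuous_dist cv dcd eps0.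
(* The midpoint keeps x to the right of y; d - e / 2 keeps it within the continuity radius of d. *)
pose x := Num.max ((y + d) / 2) (d - e / 2).
have x1 : (y + d) / 2 <= x by rewrite le_max lexx.
have x2 : d - e / 2 <= x by rewrite le_max lexx orbT.
have x3 : x < d by rewrite gt_max; apply/andP; split; lra.
have h1 : `|v x - v d| < eps.
  apply: he; first by rewrite /= in_itv/=; lra.
  by rewrite ltr0_norm; lra.
have h2 : `|v x - v y| <= `|M| * (x - y).
  by apply: (weak_derivative_Linfty_lipschitz_oo cv wv) => //; lra.
have h3 : `|M| * (x - y) <= `|M| * (d - y) by apply: ler_wpM2l => //; lra.
have -> : v d - v y = (v x - v y) - (v x - v d) by ring.
apply: (le_trans (ler_normB _ _)); lra.
Qed.

(** * One-sided derivatives *)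

Lemma is_derivative_in_dist {R : realType} (A : set R) (v : R -> R) (t d eps : R) :
  is_derivative_in A v t d -> 0 < eps ->
  exists2 e, 0 < e & forall s, A s -> s != t -> `|s - t| < e ->
    `|(v s - v t) / (s - t) - d| < eps.
Proof.
move=> /cvgrPdist_lt/(_ _)/[apply].
rewrite near_withinE => /nbhs_ballP[e /= e0 he].
exists e => // s As st ste; rewrite distrC; apply: he => //.
by rewrite /ball/= distrC.
Qed.

Lemma is_derivative_in_continuous {R : realType} (A : set R) (v : R -> R) (t d : R) :
  is_derivative_in A v t d -> v @ within A (nbhs t) --> v t.
Proof.
move=> /is_derivative_in_dist/(_ ltr01)[e e0 he].
apply/cvgrPdist_lt => eps eps0.
rewrite near_withinE; apply/nbhs_ballP.
have d1 : 0 < `|d| + 1 by rewrite ltr_wpDl.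
(* Near t the difference quotient is below |d| + 1 in absolute value, so v moves by less than (|d| +
   1) |s - t|. *)
exists (Num.min e (eps / (`|d| + 1))) => /=.
  by rewrite lt_min e0 divr_gt0.
move=> s; rewrite /ball/= lt_min distrC => /andP[se sd] As.
have [->|st] := eqVneq s t; first by rewrite subrr normr0.
have st0 : s - t != 0 by rewrite subr_eq0.
have h := he s As st se.
have -> : v t - v s = - ((v s - v t) / (s - t) - d + d) * (s - t).
  by field.
rewrite normrM normrN.
have h1 : `|(v s - v t) / (s - t) - d + d| < `|d| + 1.
  by rewrite (le_lt_trans (ler_normD _ _))// addrC ltrD2l.
rewrite (@lt_le_trans _ _ ((`|d| + 1) * `|s - t|))//.
  by rewrite ltr_pM2r// normr_gt0.
by rewrite -ler_pdivlMl// mulrC ltW.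
Qed.

Lemma is_derivative_in_is_derive {R : realType} (A : set R) (v : R -> R) (t d : R) :
  nbhs t A -> is_derivative_in A v t d -> is_derive t 1 v d.
Proof.
move=> /nbhs_ballP[r /= r0 rA] vd.
apply/is_derive1_caratheodory.
exists (fun z => if z == t then d else (v z - v t) / (z - t)); split.
- move=> z; case: eqP => [->|/eqP]; first by rewrite !subrr mulr0.
  by rewrite -subr_eq0 => /divfK->.
- apply/cvgrPdist_lt => eps eps0; rewrite eqxx.
  have [e e0 he] := is_derivative_in_dist vd eps0.
  apply/nbhs_ballP; exists (Num.min e r) => /=; first by rewrite lt_min e0.
  move=> s; rewrite /ball/= lt_min distrC => /andP[se sr].
  case: eqP => [_|/eqP st]; first by rewrite subrr normr0.
  rewrite distrC; apply: he => //.
  by apply: rA; rewrite /ball/= distrC.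
- by rewrite eqxx.
Qed.

(** G(t) = C (t + t^alpha / alpha) is a primitive of the bound, hence G + v and G - v have
    nonnegative derivatives and the mean value theorem makes them nondecreasing. One-sided
    derivatives suffice at the end points, where only continuity is required. *)
Lemma derivative_bound_increment {R : realType} (alpha C a b : R) (v : R -> R) :
  0 < alpha -> 0 <= a ->
  (forall t, t \in `]a, b] -> exists2 d, is_derivative_in `]a, b] v t d &
     `|d| <= C * (1 + t `^ (alpha - 1))) ->
  forall y z, a < y -> y <= z -> z <= b ->
  `|v z - v y| <= C * ((z - y) + (z `^ alpha - y `^ alpha) / alpha).
Proof.
move=> alpha0 a0 dv y z ay; rewrite le_eqVlt => /predU1P[<- _|yz zb].
  by rewrite !subrr mul0r addr0 normr0 mulr0.
have /choice [D hD] : forall t, exists d, t \in `]a, b] ->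
    is_derivative_in `]a, b] v t d /\ `|d| <= C * (1 + t `^ (alpha - 1)).
  move=> t; have [/dv[d d1 d2]|_] := boolP (t \in `]a, b]); first by exists d.
  by exists 0.
pose G t := C * (t + t `^ alpha / alpha).
have dG (t : R) : 0 < t -> is_derive t 1 G (C * (1 + t `^ (alpha - 1))).
  move=> t0.
  have -> : G = C \*: (id + alpha^-1 \*: (fun t => t `^ alpha)).
    by apply/funext => s; rewrite /G [_ / alpha]mulrC.
  have -> : C * (1 + t `^ (alpha - 1)) = C *: (1 + alpha^-1 *: (alpha * t `^ (alpha - 1))).
    by rewrite /GRing.scale/=; field; rewrite gt_eqF.
  have := is_derive1_powR alpha t0.
  by move=> ?; apply: is_deriveZ.
have cv (t : R) : t \in `[y, z] -> v @ within `[y, z] (nbhs t) --> v t.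
  rewrite in_itv/= => /andP[h1 h2].
  have tab : t \in `]a, b] by rewrite in_itv/=; lra.
  have [/is_derivative_in_continuous h _] := hD t tab.
  apply: cvg_trans h; apply: cvg_app; apply: within_subset => s.
  by rewrite /= !in_itv/=; lra.
(* The sign s treats G + v and G - v at once. *)
have key (s : R) : `|s| = 1 -> 0 <= (G z + s * v z) - (G y + s * v y).
  move=> s1.
  have [||c] := @MVT _ (G + s \*: v) (fun t => C * (1 + t `^ (alpha - 1)) + s *: D t) y z yz.
  - move=> t; rewrite in_itv/= => /andP[h1 h2].
    have tab : t \in `]a, b] by rewrite in_itv/=; lra.
    have [hd _] := hD t tab.
    have dvt : is_derive t 1 v (D t).
      apply: is_derivative_in_is_derive hd.
      apply: (@filterS _ _ _ `]a, b[); first by apply: subset_itvl; rewrite bnd_simp.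
      by apply: near_in_itvoo; rewrite in_itv/=; lra.
    have dGt : is_derive t 1 G (C * (1 + t `^ (alpha - 1))) by apply: dG; lra.
    exact: is_deriveD.
  - apply/subspace_continuousP => t tyz; apply: cvgD.
      apply: cvg_within_filter; apply: differentiable_continuous.
      have t0 : 0 < t by move: tyz; rewrite /= in_itv/=; lra.
      by apply/derivable1_diffP; have [] := dG t t0.
    apply: cvgM; first exact: cvg_cst.
    exact: cv.
  - rewrite in_itv/= => /andP[h1 h2] /= E.
    have cab : c \in `]a, b] by rewrite in_itv/=; lra.
    have [_ hd] := hD c cab.
    rewrite [leRHS](_ : _ = (G + s \*: v) z - (G + s \*: v) y)// E.
    apply: mulr_ge0; last lra.
    have : `|s * D c| <= C * (1 + c `^ (alpha - 1)) by rewrite normrM s1 mul1r.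
    by rewrite ler_norml => /andP[h _]; rewrite /GRing.scale/=; lra.
have k1 := key 1 (normr1 _); have k2 := key (- 1) ltac:(by rewrite normrN1).
have -> : C * (z - y + (z `^ alpha - y `^ alpha) / alpha) = G z - G y.
  by rewrite /G; ring.
by rewrite ler_norml; apply/andP; split; lra.
Qed.

(** * The truncation error *)

(** For j = 0 the function is the history, Lipschitz by its weak derivative, and the positive parts
    make the alpha-term vanish; for later periods the derivative bound is integrated. Blocks are
    open on the left, so no continuity across time 0 is claimed. *)
Lemma solution_increment {R : realType} (alpha tau M C : R) (K : nat) (w f : R -> R) :
  0 < alpha -> 0 < tau ->
  {within `[- tau, 0], continuous f} -> weak_derivative_Linfty (- tau) 0 M f ->
  (forall t, t \in `[- tau, 0] -> w t = f t) ->
  (forall (k : nat) t, (1 <= k <= K)%N -> t \in `](k%:R - 1) * tau, k%:R * tau] ->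
     exists2 d, is_derivative_in `](k%:R - 1) * tau, k%:R * tau] w t d &
       `|d| <= C * (1 + t `^ (alpha - 1))) ->
  forall j : nat, (j < K)%N ->
    measurable_fun `](j%:R - 1) * tau, j%:R * tau] w /\
    forall y z, (j%:R - 1) * tau < y -> y <= z -> z <= j%:R * tau ->
      `|w z - w y| <= (`|M| + `|C|) * (z - y) +
        `|C| / alpha * (Num.max 0 z `^ alpha - Num.max 0 y `^ alpha).
Proof.
move=> a0 tau0 cf wf wfE dw [_|j jK].
  rewrite sub0r mulN1r mul0r; split.
    apply: (@eq_measurable_fun _ _ _ _ _ f).
      by move=> t; rewrite inE/= in_itv/= => ht; rewrite wfE// in_itv/=; lra.
    apply: (@measurable_funS _ _ _ _ `[- tau, 0]%classic) => //.
      by apply: subset_itv; rewrite bnd_simp.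
    by apply: subspace_continuous_measurable_fun => //; exact: measurable_itv.
  move=> y z ty yz z0.
  rewrite !max_l; [|lra..]; rewrite subrr mulr0 addr0.
  rewrite !wfE; [|by rewrite in_itv/=; lra..].
  apply: (le_trans (weak_derivative_Linfty_lipschitz cf wf ty yz z0)).
  by apply: ler_wpM2r; [lra|rewrite lerDl].
set A := `]_, _]%classic.
have dA (t : R) : t \in `](j.+1%:R - 1) * tau, j.+1%:R * tau] ->
    exists2 d, is_derivative_in A w t d & `|d| <= `|C| * (1 + t `^ (alpha - 1)).
  (* C is replaced by |C| so that the constants are nonnegative and the Lipschitz term of the
     history can be added. *)
  move=> tA; have [d d1 d2] := dw j.+1 t (ltnW jK) tA.
  exists d => //; apply: (le_trans d2); apply: ler_wpM2r; last exact: ler_norm.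
  by rewrite addr_ge0// powR_ge0.
have j0 : 0 <= (j.+1%:R - 1) * tau by rewrite mulr_ge0 ?(ltW tau0)// subr_ge0 ler1n.
split.
  apply: subspace_continuous_measurable_fun; first exact: measurable_itv.
  apply/subspace_continuousP => t tA.
  by have [d /is_derivative_in_continuous] := dA t tA.
move=> y z jy yz zj.
have := derivative_bound_increment a0 j0 dA jy yz zj.
have -> : Num.max 0 z = z by rewrite max_r//; lra.
have -> : Num.max 0 y = y by rewrite max_r//; lra.
have h : 0 <= `|M| * (z - y) by rewrite mulr_ge0// subr_ge0.
move=> /le_trans; apply.
have -> : `|C| * (z - y + (z `^ alpha - y `^ alpha) / alpha) =
  `|C| * (z - y) + `|C| / alpha * (z `^ alpha - y `^ alpha) by ring.
by rewrite lerD2r mulrDl lerDr.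
Qed.

Lemma kernel_mass_ge0 {R : realType} (alpha T c d : R) :
  0 < alpha < 1 -> c <= d -> d <= T -> 0 <= kernel_mass alpha T c d.
Proof.
move=> a01 cd dT; rewrite /kernel_mass /omega subr_ge0.
apply: ler_wpM2r; first by rewrite invr_ge0 Gamma_ge0.
by apply: ge0_ler_powR; rewrite ?nnegrE; lra.
Qed.

(** The Lipschitz part costs c0 h times the total kernel mass, which telescopes. The alpha-part is
    [sum_powR_increments] for the shifted nodes s k = max(0, p k - tau), which start at 0 and again
    have steps at most h. *)
Lemma kernel_mass_quadrature {R : realType} (alpha tau h H c0 c1 : R) (n : nat) (p : nat -> R) :
  0 < alpha < 1 -> 0 < tau -> 0 <= h -> 0 <= c0 -> 0 <= c1 ->
  p 0 = 0 -> p n <= H ->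
  (forall k, (k < n)%N -> p k < p k.+1 <= p k + h) ->
  (forall k, (k < n)%N -> p k.+1 <= tau \/ tau <= p k) ->
  \sum_(0 <= k < n) kernel_mass alpha (p n) (p k) (p k.+1) *
    (c0 * (p k.+1 - p k) +
     c1 * (Num.max 0 (p k.+1 - tau) `^ alpha - Num.max 0 (p k - tau) `^ alpha))
  <= (c0 * H `^ (1 - alpha) + 4 * c1) / Gamma (2 - alpha) * h.
Proof.
move=> a01 tau0 h0 c00 c10 p0 pH pS ptau; case/andP: (a01) => a0 a1.
have mono i j : (i <= j)%N -> (j <= n)%N -> p i <= p j.
  elim: j => [|j IH]; first by rewrite leqn0 => /eqP->.
  rewrite leq_eqVlt => /predU1P[->//|ij] jn.
  by case/andP: (pS _ jn) => h1 _; rewrite (le_trans (IH ij (ltnW jn)))// ltW.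
have e1 : 2 - alpha - 1 = 1 - alpha by ring.
have G0 : 0 <= (Gamma (2 - alpha))^-1 by rewrite invr_ge0 Gamma_ge0.
set A := kernel_mass alpha (p n).
have A0 k : (k < n)%N -> 0 <= A (p k) (p k.+1).
  by move=> kn; apply: kernel_mass_ge0 => //; exact: mono.
pose s k := Num.max 0 (p k - tau).
have AE k : A (p k) (p k.+1) =
    ((p n - p k) `^ (1 - alpha) - (p n - p k.+1) `^ (1 - alpha)) / Gamma (2 - alpha).
  by rewrite /A /kernel_mass /omega e1 -mulrBl.
have sumA : \sum_(0 <= k < n) A (p k) (p k.+1) <= H `^ (1 - alpha) / Gamma (2 - alpha).
  under eq_bigr => k _ do rewrite /A /kernel_mass -opprB.
  rewrite sumrN telescope_sumr// opprB p0 subr0 subrr /omega e1 powR0 ?mul0r ?subr0.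
    apply: ler_wpM2r => //; apply: ge0_ler_powR; rewrite ?nnegrE//; first lra.
      by rewrite -p0; exact: mono.
    by apply: le_trans pH; rewrite -p0; exact: mono.
  by rewrite gt_eqF// subr_gt0.
have sumB : \sum_(0 <= k < n) A (p k) (p k.+1) * (s k.+1 `^ alpha - s k `^ alpha)
    <= 4 * h / Gamma (2 - alpha).
  have s0 : s 0 = 0 by rewrite /s p0 max_l//; lra.
  have sS k : (k < n)%N -> s k <= s k.+1 <= s k + h.
    move=> kn; have /andP[g1 g2] := pS k kn; rewrite /s.
    by case: (leP (p k.+1 - tau) 0) => ?; case: (leP (p k - tau) 0) => ?; lra.
  have := @sum_powR_increments _ alpha h n s a01 h0 s0 sS.
  move=> /(ler_wpM2r G0); apply: le_trans; rewrite mulr_suml.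
  rewrite big_nat [leRHS]big_nat; apply: ler_sum => k /= kn.
  rewrite AE; have /andP[g1 g2] := pS k kn.
  have g3 : p k.+1 <= p n by exact: mono.
  (* Before tau both shifted nodes are 0 and the cell contributes nothing; after tau the shift
     cancels from p n - p k, so the kernel mass is expressed by s. *)
  have [g|g] := ptau k kn.
    have -> : s k.+1 = 0 by rewrite /s max_l//; lra.
    have -> : s k = 0 by rewrite /s max_l//; lra.
    by rewrite subrr !mulr0 mul0r.
  have -> : s n - s k.+1 = p n - p k.+1 by rewrite /s !max_r; lra.
  have -> : s n - s k = p n - p k by rewrite /s !max_r; lra.
  by rewrite mulrAC.
apply: (@le_trans _ _ (\sum_(0 <= k < n) (c0 * h * A (p k) (p k.+1) +
    c1 * (A (p k) (p k.+1) * (s k.+1 `^ alpha - s k `^ alpha))))).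
  rewrite big_nat [leRHS]big_nat; apply: ler_sum => k /= kn.
  rewrite mulrDr; apply: lerD; last by rewrite mulrCA.
  rewrite mulrC; apply: ler_wpM2r; first exact: A0.
  by apply: ler_wpM2l => //; have := pS k kn; lra.
rewrite big_split/= -!mulr_sumr.
have := ler_wpM2l (mulr_ge0 c00 h0) sumA; have := ler_wpM2l c10 sumB.
set G := (Gamma _)^-1.
have -> : (c0 * H `^ (1 - alpha) + 4 * c1) * G * h =
   c0 * h * (H `^ (1 - alpha) * G) + c1 * (4 * h * G) by ring.
lra.
Qed.

Lemma within_continuous_slice {R : realType} (A B : set R) (f : R -> R -> R) (x : R) :
  {within A `*` B, continuous (fun z : R * R => f z.1 z.2)} -> A x ->
  {within B, continuous (f x)}.
Proof.
move=> /subspace_continuousP cf Ax; apply/subspace_continuousP => t Bt.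
have h := cf (x, t) (conj Ax Bt).
apply: (@cvg_comp _ _ _ (fun s => (x, s)) (fun z : R * R => f z.1 z.2) _ _ _ _ h).
move=> P hP.
have {}hP : \forall z \near (x, t), (A `*` B) z -> P z by exact: hP.
suff : \forall s \near t, B s -> P (x, s) by [].
case: hP => -[U V] /= [nU nV] UV.
apply: filterS nV => s Vs Bs; apply: (UV (x, s)) => //; split => //.
exact: nbhs_singleton nU.
Qed.

(** The step cancels the denominator of [weight], which needs strictly increasing nodes; the
    summation index is lowered by one so that cell k runs from t_k to t_(k+1). *)
Lemma J_delayedE {R : realType} (alpha tau : R) (N : nat) (t : int -> R) (v : R -> R) (n : nat) :
  (forall k, (k < n)%N -> t k%:Z < t k.+1%:Z) ->
  (forall k, (k < n)%N -> t (k.+1%:Z - 2 * N%:Z) = t k.+1%:Z - tau) ->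
  J_delayed alpha N t v n = \sum_(0 <= k < n)
    kernel_mass alpha (t n%:Z) (t k%:Z) (t k.+1%:Z) * v (t k.+1%:Z - tau).
Proof.
move=> tS tD; rewrite /J_delayed big_add1/= big_nat [RHS]big_nat.
apply: eq_bigr => k /= kn.
have e : k.+1%:Z - 1 = k%:Z by lia.
rewrite tD// /weight /mesh_step /kernel_mass e mulrCA divff ?mulr1//.
by rewrite subr_eq0 gt_eqF// tS.
Qed.

Theorem lemma2p1 (R : realType) (alpha tau L p a b r : R) (K : nat)
    (f phi u : R -> R -> R)
    (halpha : 0 < alpha < 1) (htau : 0 < tau) (hL : 0 < L) (hK : (0 < K)%N)
    (hp : 0 < p) (ha : a <= 0) (hb : b != 0) (hr : 1 <= r)
    (hf : {within `]0, L[ `*` `]0, K%:R * tau],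
             continuous (fun z : R * R => f z.1 z.2)})
    (hphi : {within `]0, L[ `*` `[- tau, 0],
               continuous (fun z : R * R => phi z.1 z.2)})
    (hu : exact_solution L tau K alpha p a b f phi u)
    (hdu : exists C : R, forall (k : nat) (x t : R),
       (1 <= k <= K)%N -> x \in `]0, L[ ->
       t \in `](k%:R - 1) * tau, k%:R * tau] ->
       exists2 d : R,
         is_derivative_in `](k%:R - 1) * tau, k%:R * tau] (u x) t d &
         `|d| <= C * (1 + t `^ (alpha - 1)))
    (hdphi : exists M : R, forall x : R, x \in `]0, L[ ->
       weak_derivative_Linfty (- tau) 0 M (phi x)) :
  exists2 C : R, 0 < C &
    forall (N : nat) (t : int -> R),
      (2 <= N)%N -> symmetric_graded_mesh tau r K N t ->
      forall (n : nat) (x : R), (1 <= n <= 2 * K * N)%N -> x \in `]0, L[ ->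
        `|J_delayed alpha N t (u x) n - I_delayed alpha tau t (u x) n|
        <= C * (mesh_step t 1) `^ (r^-1).
Proof.
case: hdu => C hC; case: hdphi => M hM.
have /andP[a0 a1] := halpha.
(* A natural number above r, for the Bernoulli bound on the mesh steps. *)
pose q := Num.bound r.
have rq : r <= q%:R by apply/ltW/archi_boundP; lra.
pose c0 := `|M| + `|C|; pose c1 := `|C| / alpha.
have c00 : 0 <= c0 by rewrite addr_ge0.
have c10 : 0 <= c1 by rewrite divr_ge0// ltW.
pose B := (c0 * (K%:R * tau) `^ (1 - alpha) + 4 * c1) / Gamma (2 - alpha).
have B0 : 0 <= B.
  by rewrite /B divr_ge0 ?Gamma_ge0// addr_ge0// mulr_ge0// powR_ge0.
have s0 : 0 < (tau / 2) `^ r^-1 by rewrite powR_gt0//; lra.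
(* The error is at most B h with h = tau q / N, and 1/N is rho_1^(1/r) divided by (tau / 2)^(1/r);
   adding 1 makes the constant positive even if B = 0. *)
exists (B * tau * q%:R / (tau / 2) `^ r^-1 + 1).
  by apply: ltr_wpDl => //; apply: divr_ge0 (ltW s0); rewrite mulr_ge0// mulr_ge0// (ltW htau).
move=> N t N2 tm n x /andP[n0 nKN] xL.
have N0 : (0 < N)%N by exact: ltnW.
have cell k : (k < n)%N -> _ := fun kn =>
  @mesh_cell _ tau r K N q k t htau hr rq N0 tm (leq_trans kn nKN).
have [t0 t1] := mesh_step1 htau hr hK N2 tm.
have blocks := solution_increment a0 htau
  (within_continuous_slice hphi (xL : `]0, L[%classic x)) (hM x xL)
  (fun s hs => sol_init hu xL hs) (fun k s hk hs => hC k x s hk xL hs).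
pose h := tau * (q%:R / N%:R).
have h0 : 0 <= h by rewrite mulr_ge0 ?(ltW htau)// divr_ge0.
pose e k := c0 * (t k.+1%:Z - t k%:Z) +
  c1 * (Num.max 0 (t k.+1%:Z - tau) `^ alpha - Num.max 0 (t k%:Z - tau) `^ alpha).
(* Bounding the final time by K tau makes the kernel mass uniform in n. *)
have tn : t n%:Z <= K%:R * tau.
  case: n n0 {nKN e} cell => // n _ cell.
  have [[j jK [_ h2]] _ _] := cell n (ltnSn _).
  by apply: (le_trans h2); apply: ler_wpM2r; [exact: ltW|rewrite ler_nat].
rewrite (@J_delayedE _ alpha tau); last 2 first.
- by move=> k kn; have [_ /andP[]] := cell k kn.
- by move=> k kn; have [] := cell k kn.
apply: (@le_trans _ _ (\sum_(0 <= k < n)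
    kernel_mass alpha (t n%:Z) (t k%:Z) (t k.+1%:Z) * e k)).
  apply: (@piecewise_constant_quadrature _ alpha n (fun k => t k%:Z) e
    (fun s => u x (s - tau)) halpha t0).
  - by move=> k kn; have [_ /andP[]] := cell k kn.
  - move=> k kn; have [[j jK [h1 h2]] _ _] := cell k kn.
    have [mj _] := blocks j jK.
    apply: (measurable_comp _ _ mj); first exact: measurable_itv.
      move=> _ [s hs <-]; move: hs; rewrite /= !in_itv/= -natr1 in h2 *; lra.
    by apply: measurable_funB.
  (* The cell shifted by -tau lies in a single block, open on its left, so the increment bound
     applies between s - tau and the right node. Monotonicity then replaces s by the left node. *)
  - move=> k s kn /andP[ks sk]; have [[j jK [h1 h2]] /andP[g1 g2] _] := cell k kn.
    have [_ inc] := blocks j jK.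
    rewrite -natr1 in h2.
    have /le_trans := inc (s - tau) (t k.+1%:Z - tau) ltac:(lra) ltac:(lra) ltac:(lra).
    apply; rewrite -/c0 -/c1 /e; apply: lerD; first by apply: ler_wpM2l => //; lra.
    apply: ler_wpM2l => //; rewrite lerD2l lerN2.
    apply: ge0_ler_powR; [exact: ltW|by rewrite nnegrE le_max lexx..|].
    by rewrite ge_max !le_max lexx/=; apply/orP; right; lra.
apply: (@le_trans _ _ (B * h)).
  apply: (kernel_mass_quadrature halpha htau h0 c00 c10 t0 tn).
  - by move=> k kn; have [_] := cell k kn.
  (* Cells of period 0 end by tau; those of every later period start at or after tau. *)
  - move=> k kn; have [[[|j] jK [h1 h2]] _ _] := cell k kn.
      by left; rewrite mul1r in h2.
    by right; apply: le_trans h1; rewrite ler_peMl ?(ltW htau)// ler1n.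
rewrite t1 mulrDl mul1r.
have -> : B * tau * q%:R / (tau / 2) `^ r^-1 * ((tau / 2) `^ r^-1 / N%:R) = B * h.
  by rewrite /h; field; rewrite pnatr_eq0 -lt0n N0 gt_eqF.
by rewrite lerDl divr_ge0// ltW.
Qed.
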